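(* Let $n,d,h$ be positive integers and let $f(x_1,\ldots,x_n)\in\mathbb{Z}[[x_1,\ldots,x_n]]$ be a power series that is algebraic over $\mathbb{Q}(x_1,\ldots,x_n)$, of degree at most $d$ and height at most $h$. Then there exists an effective constant $A:=A(n,d,h)$, depending only on $n$, $d$ and $h$, such that for every prime number $p$ the power series $\Delta(f)_{\vert p}\in\mathbb{F}_p[[x]]$ is algebraic over $\mathbb{F}_p(x)$ of degree at most $p^{A}$ and height at most $A^2p^{A+1}$.
   Context: For a field $K$ and $g=\sum_{(i_1,\ldots,i_n)\in\mathbb{N}^n}a(i_1,\ldots,i_n)x_1^{i_1}\cdots x_n^{i_n}\in K[[x_1,\ldots,x_n]]$, the diagonal of $g$ is $\Delta(g)(x):=\sum_{m\ge0}a(m,\ldots,m)x^m\in K[[x]]$. A power series $g\in K[[x_1,\ldots,x_n]]$ is algebraic if there are polynomials $A_0,\ldots,A_m\in K[x_1,\ldots,x_n]$, not all zero, with $\sum_{i=0}^m A_i g^i=0$; its degree is the least such $m$. The height of a polynomial $P(Y)\in K[x_1,\ldots,x_n][Y]$ is the maximum of the total degrees of its coefficients, and the height of an algebraic $g$ is the minimum of the heights of the nonzero polynomials $P(Y)\in K[x_1,\ldots,x_n][Y]$ with $P(g)=0$. For $g=\sum a(m)x^m\in\mathbb{Z}[[x]]$ and a prime $p$, $g_{\vert p}:=\sum (a(m)\bmod p)x^m\in\mathbb{F}_p[[x]]$. *)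

(* Defs.v *)
From HB Require Import structures.
From mathcomp Require Import all_boot all_order all_algebra.
From mathcomp.multinomials Require Export mpoly.

Set Implicit Arguments.
Unset Strict Implicit.
Unset Printing Implicit Defensive.

Import GRing.Theory.
Local Open Scope ring_scope.

(* R[[x_1, ..., x_n]], a series being identified with its coefficients. *)
Definition pseries (n : nat) (R : Type) : Type := 'X_{1..n} -> R.

Section Operations.
Variables (n : nat) (R : comNzRingType).
Implicit Types f g : pseries n R.

Definition ps_of_mpoly (p : {mpoly R[n]}) : pseries n R := fun m => p@_m.

(* Cauchy product; the bound on mdeg k only makes the index type finite. *)
Definition ps_mul f g : pseries n R :=
  fun m => \sum_(k : 'X_{1..n < (mdeg m).+1} | (k <= m)%MM)
             f k * g (m - k)%MM.

Definition ps_exp f (i : nat) : pseries n R := iter i (ps_mul f) (ps_of_mpoly 1).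

(* P(g), for P a polynomial in Y with coefficients in R[x_1, ..., x_n]. *)
Definition ps_eval (P : {poly {mpoly R[n]}}) g : pseries n R :=
  fun m => \sum_(i < size P) ps_mul (ps_of_mpoly P`_i) (ps_exp g i) m.

End Operations.

Definition annihilates (n : nat) (K : fieldType)
    (P : {poly {mpoly K[n]}}) (g : pseries n K) : Prop :=
  P != 0 /\ forall m, ps_eval P g m = 0.

Definition ps_algebraic (n : nat) (K : fieldType) (g : pseries n K) : Prop :=
  exists P, annihilates P g.

(* msize is the total degree plus one, and 0 for the zero polynomial. *)
Definition poly_height (n : nat) (K : fieldType) (P : {poly {mpoly K[n]}}) : nat :=
  \max_(i < size P) (msize P`_i).-1.

Definition is_least (S : nat -> Prop) (m : nat) : Prop :=
  S m /\ forall k, S k -> (m <= k)%N.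

Definition has_degree (n : nat) (K : fieldType) (g : pseries n K) : nat -> Prop :=
  is_least (fun m => exists2 P, annihilates P g & (size P <= m.+1)%N).

Definition has_height (n : nat) (K : fieldType) (g : pseries n K) : nat -> Prop :=
  is_least (fun m => exists2 P, annihilates P g & poly_height P = m).

(* The degree and the height may be attained by different polynomials. *)
Definition algebraic_bounded (n : nat) (K : fieldType) (g : pseries n K)
    (d h : nat) : Prop :=
  [/\ ps_algebraic g,
      exists2 e, has_degree g e & (e <= d)%N
    & exists2 k, has_height g k & (k <= h)%N].

Definition ps_intr (n : nat) (R : pzRingType) (f : pseries n int) : pseries n R :=
  fun m => (f m)%:~R.
Arguments ps_intr {n} R f.

Definition diagonal (n : nat) (R : Type) (f : pseries n R) : pseries 1 R :=
  fun m => f [multinom m ord0 | _ < n].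

(* Total recursive functions nat^k -> nat: the closure of the basic functions
   under composition, primitive recursion and minimization of regular
   functions. Constructors state pointwise equations, so that the class is
   closed under extensional equality. *)
Inductive recursive : forall k : nat, (k.-tuple nat -> nat) -> Prop :=
| rec_zero k (h : k.-tuple nat -> nat) :
    (forall v, h v = 0%N) -> recursive h
| rec_succ (h : 1.-tuple nat -> nat) :
    (forall v, h v = (tnth v ord0).+1) -> recursive h
| rec_proj k (i : 'I_k) (h : k.-tuple nat -> nat) :
    (forall v, h v = tnth v i) -> recursive h
| rec_comp k m (f : m.-tuple nat -> nat) (g : 'I_m -> k.-tuple nat -> nat)
    (h : k.-tuple nat -> nat) :
    recursive f -> (forall i, recursive (g i)) ->
    (forall v, h v = f [tuple g i v | i < m]) -> recursive h
| rec_prim k (f : k.-tuple nat -> nat) (g : k.+2.-tuple nat -> nat)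
    (h : k.+1.-tuple nat -> nat) :
    recursive f -> recursive g ->
    (forall v : k.-tuple nat, h [tuple of 0%N :: v] = f v) ->
    (forall y (v : k.-tuple nat),
       h [tuple of y.+1 :: v] = g [tuple of y :: h [tuple of y :: v] :: v]) ->
    recursive h
| rec_min k (f : k.+1.-tuple nat -> nat) (h : k.-tuple nat -> nat) :
    recursive f ->
    (forall v : k.-tuple nat,
       is_least (fun y => f [tuple of y :: v] = 0%N) (h v)) ->
    recursive h.

(* Main.v *)
(* Let g be a series over F_p with P(g) = 0, deg_Y P <= d, height <= h, and
   delta := P_Y(g) != 0. The series w such that w * delta = S(g) for some S with
   deg_Y S <= d and height <= h form an F_p-space W of dimension at most
   N = (d + 1)(h + 1)^n, independently of p. It contains g, and it is stable
   under the Cartier operators L_r, because L_r(w) * delta = S'(g) where S' is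
   the section of S * P^(p-1) along the exponents (r, p - 1) in (x, Y). Since
   diagonals commute with Cartier operators, every v in Delta(W) is the sum of
   the x^i * v_i^p for some v_i in Delta(W), i < p; iterating, the x^i * Delta(g)^(p^k)
   with k <= N and i <= N p^N are all of the form sum_(j < N p^N + p^N)
   x^j * v_j^(p^N). There are fewer families (v_j) than linear combinations of
   those elements with coefficients in F_p, so two combinations coincide, and
   their difference is an equation of Delta(g) of degree <= p^N and height
   <= N p^N.

   An equation with delta != 0 is obtained by descent: if P_Y = 0 then
   P(g) = Q(g^p), and a Cartier operator yields a smaller equation for g.

   The bounds on degree and height in characteristic 0 are realized by one
   polynomial by Gauss' lemma over Q[x_1, ..., x_n]: a polynomial of minimal
   degree divides the one of minimal height, and heights add up in products.
   A suitable multiple has integral coefficients, not all divisible by p. *)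
Require Import Defs.
From HB Require Import structures.
From mathcomp Require Import all_boot all_order all_algebra.
From mathcomp.multinomials Require Import mpoly.
From mathcomp Require boolp.
From mathcomp Require Import zify.

Set Implicit Arguments.
Unset Strict Implicit.
Unset Printing Implicit Defensive.

Import Order.TTheory GRing.Theory Num.Theory.
Local Open Scope ring_scope.

(** * The ring of power series *)

(** A named copy of [pseries], so that ring instances are declared on it and not on a bare function
    type. *)
Definition series (n : nat) (R : comNzRingType) : Type := pseries n R.
Identity Coercion pseries_of_series : series >-> pseries.

HB.instance Definition _ n R := boolp.gen_eqMixin (series n R).
HB.instance Definition _ n R := boolp.gen_choiceMixin (series n R).

Section SeriesRing.
Variables (n : nat) (R : comNzRingType).
Implicit Types (f g h : series n R) (p q : {mpoly R[n]}).

Lemma seriesP f g : (forall m, f m = g m) <-> f = g.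
Proof. by split=> [e|-> //]; apply: boolp.funext. Qed.

Definition ser_of_mpoly p : series n R := ps_of_mpoly p.
(* The operations are locked: unfolding them makes unification diverge. *)
Fact series_key : unit. Proof. exact: tt. Qed.
Definition ser0 : series n R := fun=> 0.
Definition ser_opp f : series n R := locked_with series_key (fun m => - f m).
Definition ser_add f g : series n R := locked_with series_key (fun m => f m + g m).
Definition ser_mul f g : series n R := locked_with series_key (ps_mul f g).

Lemma ser_oppE f m : ser_opp f m = - f m.
Proof. by rewrite /ser_opp locked_withE. Qed.

Lemma ser_addE f g m : ser_add f g m = f m + g m.
Proof. by rewrite /ser_add locked_withE. Qed.

Lemma ser_mulE f g : ser_mul f g = ps_mul f g.
Proof. exact: locked_withE. Qed.

(** A coefficient of a product in degree below [D] depends only on the truncations at [D]. Ring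
    identities for series are thereby inherited from polynomials. *)
Definition trunc (D : nat) f : {mpoly R[n]} :=
  \sum_(m : 'X_{1..n < D}) f m *: 'X_[m].

Lemma mcoeff_trunc D f m : (mdeg m < D)%N -> (trunc D f)@_m = f m.
Proof.
move=> mD; rewrite /trunc raddf_sum /= (bigD1 (BMultinom mD)) //=.
rewrite mcoeffZ mcoeffX eqxx mulr1 big1 ?addr0 // => k kne.
rewrite mcoeffZ mcoeffX; case: eqP => [e|]; rewrite ?mulr0 //.
by case/eqP: kne; apply/val_inj.
Qed.

Lemma eq_ser_mul D f f' g g' m : (mdeg m < D)%N ->
  (forall k, (mdeg k < D)%N -> f k = f' k) ->
  (forall k, (mdeg k < D)%N -> g k = g' k) ->
  ser_mul f g m = ser_mul f' g' m.
Proof.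
move=> mD ef eg; rewrite !ser_mulE; apply: eq_bigr => k km; congr (_ * _).
  by apply: ef; apply: leq_trans mD; apply: bmdeg.
by apply: eg; apply: leq_ltn_trans mD; apply: mdegB.
Qed.

Lemma ser_of_mpolyM p q : ser_of_mpoly (p * q) = ser_mul (ser_of_mpoly p) (ser_of_mpoly q).
Proof. by apply/seriesP => m; rewrite ser_mulE; apply: mcoeff_poly_mul_lin. Qed.

Lemma ser_mul_trunc D f g m : (mdeg m < D)%N ->
  ser_mul f g m = (trunc D f * trunc D g)@_m.
Proof.
move=> mD; rewrite -[RHS]/(ser_of_mpoly _ m) ser_of_mpolyM.
by apply: (eq_ser_mul mD) => k kD; rewrite /ser_of_mpoly /ps_of_mpoly mcoeff_trunc.
Qed.

Lemma ser_addA : associative ser_add.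
Proof. by move=> f g h; apply/seriesP => m; rewrite !(ser_addE, ser_oppE) addrA. Qed.
Lemma ser_addC : commutative ser_add.
Proof. by move=> f g; apply/seriesP => m; rewrite !(ser_addE, ser_oppE) addrC. Qed.
Lemma ser_add0 : left_id ser0 ser_add.
Proof. by move=> f; apply/seriesP => m; rewrite !(ser_addE, ser_oppE) add0r. Qed.
Lemma ser_addN : left_inverse ser0 ser_opp ser_add.
Proof. by move=> f; apply/seriesP => m; rewrite !(ser_addE, ser_oppE) addNr. Qed.

HB.instance Definition _ := GRing.isZmodule.Build (series n R)
  ser_addA ser_addC ser_add0 ser_addN.

Lemma ser_mulC : commutative ser_mul.
Proof.
by move=> f g; apply/seriesP => m; rewrite !(ser_mul_trunc _ _ (ltnSn _)) mulrC.
Qed.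

Lemma ser_mulA : associative ser_mul.
Proof.
move=> f g h; apply/seriesP => m; set D := (mdeg m).+1.
have mD : (mdeg m < D)%N by [].
pose T f := ser_of_mpoly (trunc D f).
have eT f' k : (mdeg k < D)%N -> f' k = T f' k.
  by move=> kD; rewrite /T /ser_of_mpoly /ps_of_mpoly mcoeff_trunc.
have eT2 f' g' k : (mdeg k < D)%N -> ser_mul f' g' k = ser_mul (T f') (T g') k.
  by move=> kD; apply: (eq_ser_mul kD); apply: eT.
rewrite (eq_ser_mul mD (eT f) (eT2 g h)) (eq_ser_mul mD (eT2 f g) (eT h)).
by rewrite -!ser_of_mpolyM mulrA.
Qed.

Lemma ser_mul1 : left_id (ser_of_mpoly 1) ser_mul.
Proof.
move=> f; apply/seriesP => m; have mD := ltnSn (mdeg m).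
rewrite (@eq_ser_mul _ _ (ser_of_mpoly 1) _ (ser_of_mpoly (trunc (mdeg m).+1 f)) m mD) //.
  by rewrite -ser_of_mpolyM mul1r /ser_of_mpoly /ps_of_mpoly mcoeff_trunc.
by move=> k kD; rewrite /ser_of_mpoly /ps_of_mpoly mcoeff_trunc.
Qed.

Lemma ser_mulDl : left_distributive ser_mul ser_add.
Proof.
move=> f g h; apply/seriesP => m; rewrite ser_addE !ser_mulE /ps_mul -big_split.
by apply: eq_bigr => k _; rewrite ser_addE mulrDl.
Qed.

Lemma ser1_neq0 : ser_of_mpoly 1 != 0.
Proof.
apply/eqP => /seriesP /(_ 0%MM).
by rewrite /ser_of_mpoly /ps_of_mpoly mcoeff1 eqxx => /eqP; rewrite oner_eq0.
Qed.

HB.instance Definition _ := GRing.Zmodule_isComNzRing.Build (series n R)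
  ser_mulA ser_mulC ser_mul1 ser_mulDl ser1_neq0.

Lemma serD f g m : (f + g) m = f m + g m. Proof. exact: ser_addE. Qed.
Lemma serN f m : (- f) m = - f m. Proof. exact: ser_oppE. Qed.

Lemma ser_of_mpoly_is_additive : zmod_morphism ser_of_mpoly.
Proof.
by move=> p q; apply/seriesP => m; rewrite serD serN /ser_of_mpoly /ps_of_mpoly mcoeffB.
Qed.

Lemma ser_of_mpoly_is_multiplicative : monoid_morphism ser_of_mpoly.
Proof. by split=> // p q; apply: ser_of_mpolyM. Qed.

HB.instance Definition _ := GRing.isZmodMorphism.Build
  {mpoly R[n]} (series n R) ser_of_mpoly ser_of_mpoly_is_additive.
HB.instance Definition _ := GRing.isMonoidMorphism.Build
  {mpoly R[n]} (series n R) ser_of_mpoly ser_of_mpoly_is_multiplicative.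

Lemma ser_of_mpoly_inj : injective ser_of_mpoly.
Proof. by move=> p q /seriesP e; apply/mpolyP => m; apply: e. Qed.

Lemma ser0E m : (0 : series n R) m = 0. Proof. by []. Qed.
Lemma ser_sum I (r : seq I) (P : pred I) (F : I -> series n R) m :
  (\sum_(i <- r | P i) F i) m = \sum_(i <- r | P i) F i m.
Proof. by elim/big_rec2: _ => // i y1 y2 _ <-; rewrite serD. Qed.
Lemma serM f g m : (f * g) m =
  \sum_(k : 'X_{1..n < (mdeg m).+1} | (k <= m)%MM) f k * g (m - k)%MM.
Proof. by rewrite -[f * g]/(ser_mul f g) ser_mulE. Qed.

Lemma ser_of_mpolyE p m : ser_of_mpoly p m = p@_m. Proof. by []. Qed.

Lemma ser1E m : (1 : series n R) m = (m == 0%MM)%:R.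
Proof. exact: mcoeff1. Qed.

Definition serX k : series n R := ser_of_mpoly 'X_[k].

Lemma serXE k m : serX k m = (k == m)%:R.
Proof. exact: mcoeffX. Qed.

Lemma serXM k f m : (serX k * f) m = if (k <= m)%MM then f (m - k)%MM else 0.
Proof.
have [D mD] : exists D, (mdeg m < D)%N by exists (mdeg m).+1.
rewrite -[LHS]/(ser_mul (serX k) f m).
rewrite (@eq_ser_mul _ (serX k) (serX k) _ (ser_of_mpoly (trunc D f)) m mD) //; last first.
  by move=> j kD; rewrite ser_of_mpolyE mcoeff_trunc.
rewrite -ser_of_mpolyM ser_of_mpolyE mulrC; case: ifP => km.
  rewrite -[in LHS](submK km) addmC mcoeffMX mcoeff_trunc //.
  exact: leq_ltn_trans (mdegB _ _) mD.
apply: memN_msupp_eq0; rewrite (perm_mem (msuppMX _ _)).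
by apply/mapP => -[j _ e]; rewrite e lem_addr in km.
Qed.

Lemma ps_expE f i : ps_exp f i = f ^+ i.
Proof. by elim: i => [|i IH] //; rewrite exprS -IH -[f * _]/(ser_mul f _) ser_mulE. Qed.

(** Bridge from the evaluation used in the definitions to Horner evaluation in the ring of
    series. *)
Lemma ps_evalE (P : {poly {mpoly R[n]}}) f :
  ps_eval P f = (map_poly ser_of_mpoly P).[f].
Proof.
apply: boolp.funext => m; rewrite (@horner_coef_wide _ (size P)) ?size_poly //.
rewrite ser_sum; apply: eq_bigr => i _; rewrite coef_map /= ps_expE.
by rewrite -[ser_of_mpoly _ * _]/(ser_mul _ _) ser_mulE.
Qed.

End SeriesRing.

(** * Change of coefficient ring *)

Section SeriesMap.
Variables (n : nat) (R S : comNzRingType) (phi : {rmorphism R -> S}).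

Definition ser_map (f : series n R) : series n S := fun m => phi (f m).

Lemma ser_map_is_additive : zmod_morphism ser_map.
Proof. by move=> f g; apply/seriesP => m; rewrite /ser_map !(serD, serN) rmorphB. Qed.

Lemma ser_map_is_multiplicative : monoid_morphism ser_map.
Proof.
split=> [|f g]; apply/seriesP => m; rewrite /ser_map.
  by rewrite !ser1E rmorph_nat.
by rewrite !serM rmorph_sum; apply: eq_bigr => k _; rewrite rmorphM.
Qed.

HB.instance Definition _ := GRing.isZmodMorphism.Build
  (series n R) (series n S) ser_map ser_map_is_additive.
HB.instance Definition _ := GRing.isMonoidMorphism.Build
  (series n R) (series n S) ser_map ser_map_is_multiplicative.

Lemma ser_mapX k : ser_map (serX R k) = serX S k.
Proof.
by apply/seriesP => m; rewrite /ser_map !serXE rmorph_nat.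
Qed.

End SeriesMap.

(** * Series over a domain form a domain *)

Section SeriesDomain.
Variables (n : nat) (R : idomainType).
Implicit Types f g : series n R.

Lemma ser_least_coef f : f != 0 ->
  exists2 m, f m != 0 & forall k, (k < m)%O -> f k = 0.
Proof.
move=> fn0; have [m0 fm0] : exists m, f m != 0.
  apply: boolp.contrapT => /boolp.forallNP nf; case/eqP: fn0.
  by apply/seriesP => m; move: (nf m) => /negP; rewrite negbK => /eqP.
move: fm0; elim/(@ltmwf n): m0 => m IH fm.
have [[k km fk]|nk] := boolp.pselect (exists2 k, (k < m)%O & f k != 0).
  exact: IH km fk.
exists m => // k km; apply/eqP; apply/negPn/negP => fk; apply: nk; by exists k.
Qed.

(** The monomial order is compatible with addition, so the two least terms [a] and [b] give the only
    contribution to the coefficient at [a + b]. *)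
Lemma ser_mul_neq0 f g : f != 0 -> g != 0 -> f * g != 0.
Proof.
move=> /ser_least_coef[a fa la] /ser_least_coef[b gb lb].
apply/eqP => /seriesP /(_ (a + b)%MM); rewrite serM ser0E.
have aD : (mdeg a < (mdeg (a + b)).+1)%N by rewrite ltnS mdegD leq_addr.
have other (k : 'X_{1..n}) : (k <= a + b)%MM -> k != a -> f k * g (a + b - k)%MM = 0.
  move=> kab kna; have [ka|ak|e] := ltgtP k a; last by rewrite e eqxx in kna.
    by rewrite la ?mul0r.
  rewrite (lb (a + b - k)%MM) ?mulr0 // -(ltmc_add2l _ _ k) (submK kab).
  by rewrite addmC ltmc_add2r.
rewrite (bigD1 (BMultinom aD)) /= ?lem_addr // big1 ?addr0; last first.
  by move=> k /andP[kab kne]; apply: other.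
rewrite addmC addmK => /eqP; rewrite mulf_eq0.
by rewrite (negPf fa) (negPf gb).
Qed.

Lemma ser_mulf_eq0 f g : f * g = 0 -> (f == 0) || (g == 0).
Proof.
move=> /eqP; apply: contraLR; rewrite negb_or => /andP[]; exact: ser_mul_neq0.
Qed.

Lemma ser_mulIf h : h != 0 -> injective (fun f => f * h).
Proof.
move=> hn0 f g /eqP; rewrite -subr_eq0 -mulrBl => /eqP /ser_mulf_eq0.
by rewrite (negPf hn0) orbF subr_eq0 => /eqP.
Qed.

End SeriesDomain.

(** * Polynomials as series of bounded degree *)

Section PolyLe.
Variables (n : nat) (R : comNzRingType).
Implicit Types f g : series n R.

(** Polynomials of bounded degree are kept inside the ring of series, where the Cartier operators
    act on them. *)
Definition deg_le (h : nat) f := forall m, (h < mdeg m)%N -> f m = 0.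

Lemma deg_leW h h' f : (h <= h')%N -> deg_le h f -> deg_le h' f.
Proof. by move=> hh' fh m mh; apply: fh; apply: leq_ltn_trans mh. Qed.

Lemma deg_le0 h : deg_le h 0. Proof. by []. Qed.

Lemma deg_leD h f g : deg_le h f -> deg_le h g -> deg_le h (f + g).
Proof. by move=> fh gh m mh; rewrite serD fh ?gh ?addr0. Qed.

Lemma deg_leM h h' f g : deg_le h f -> deg_le h' g -> deg_le (h + h') (f * g).
Proof.
move=> fh gh m mh; rewrite serM big1 // => k km.
have [hk|kh] := ltnP h (mdeg k); first by rewrite fh ?mul0r.
rewrite gh ?mulr0 // ltnNge; apply: contraL mh => mk.
by rewrite -leqNgt -(submK km) mdegD addnC leq_add.
Qed.

Lemma deg_le1 : deg_le 0 1.
Proof.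
by move=> m m0; rewrite ser1E -mdeg_eq0; case: (mdeg m) m0.
Qed.

Lemma deg_le_sum h I (r : seq I) (P : pred I) (F : I -> series n R) :
  (forall i, P i -> deg_le h (F i)) -> deg_le h (\sum_(i <- r | P i) F i).
Proof.
by move=> FP; elim/big_rec: _ => [|i y Pi]; [exact: deg_le0|apply: deg_leD; exact: FP].
Qed.

Lemma deg_leMn h f k : deg_le h f -> deg_le h (f *+ k).
Proof.
by move=> fh; elim: k => [|k IH]; rewrite ?mulr0n // mulrS; apply: deg_leD.
Qed.

Lemma deg_leP h f : deg_le h f <->
  exists2 q : {mpoly R[n]}, f = ser_of_mpoly q & (msize q <= h.+1)%N.
Proof.
split=> [fh|[q -> qh] m mh]; last first.
  by rewrite ser_of_mpolyE memN_msupp_eq0 //; apply: msize_mdeg_ge; apply: leq_trans mh.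
exists (trunc h.+1 f).
  apply/seriesP => m; rewrite ser_of_mpolyE.
  have [mh|mh] := ltnP (mdeg m) h.+1; first by rewrite mcoeff_trunc.
  rewrite fh // /trunc raddf_sum big1 //= => k _; rewrite mcoeffZ mcoeffX.
  case: eqP => [e|]; rewrite ?mulr0 //; move: (bmdeg k); by rewrite ltnNge e mh.
apply: leq_trans (msize_sum _ _ _) _; apply/bigmax_leqP => k _.
apply: leq_trans (mmeasureZ_le _ _ _) _; rewrite mmeasureX; exact: bmdeg.
Qed.

Definition coefs_le (h : nat) (P : {poly series n R}) := forall i, deg_le h P`_i.

Lemma coefs_leD h P Q : coefs_le h P -> coefs_le h Q -> coefs_le h (P + Q).
Proof. by move=> Ph Qh i; rewrite coefD; apply: deg_leD. Qed.

Lemma coefs_leM h h' P Q :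
  coefs_le h P -> coefs_le h' Q -> coefs_le (h + h') (P * Q).
Proof.
by move=> Ph Qh i; rewrite coefM; apply: deg_le_sum => j _; apply: deg_leM.
Qed.

Lemma coefs_le1 : coefs_le 0 1.
Proof. by move=> i; rewrite coef1; case: eqP => _; [exact: deg_le1|exact: deg_le0]. Qed.

Lemma coefs_le_exp h P k : coefs_le h P -> coefs_le (h * k) (P ^+ k).
Proof.
move=> Ph; elim: k => [|k IH]; first by rewrite muln0; exact: coefs_le1.
by rewrite exprS mulnS; apply: coefs_leM.
Qed.

Lemma coefs_leX : coefs_le 0 'X.
Proof. by move=> i; rewrite coefX; case: eqP => _; [exact: deg_le1|exact: deg_le0]. Qed.

Lemma coefs_le_deriv h P : coefs_le h P -> coefs_le h P^`().
Proof. by move=> Ph i; rewrite coef_deriv; apply: deg_leMn. Qed.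

End PolyLe.

(** * Cartier operators *)

Section SectionOperator.
Variables (R : comNzRingType) (p : nat) (L : {additive R -> R}).
Hypothesis charRp : p \in [pchar R].
Hypothesis L_semilinear : forall a b, L (a ^+ p * b) = a * L b.
Implicit Types (f w : R) (F G P S : {poly R}).

(** With [L] the Cartier operator of residue [r] in the variables x, this is the Cartier operator of
    residue [(r, p - 1)] in the variables [(x, Y)]. *)
Definition poly_section F : {poly R} := \poly_(k < size F) L F`_(p * k + p.-1).

Let p_gt0 : (0 < p)%N. Proof. exact/prime_gt0/(pcharf_prime charRp). Qed.

Lemma coef_poly_section F k : (poly_section F)`_k = L F`_(p * k + p.-1).
Proof.
rewrite coef_poly; case: ltnP => // Fk; rewrite nth_default ?raddf0 //.
by apply: (leq_trans Fk); rewrite (leq_trans (leq_pmull _ p_gt0)) // leq_addr.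
Qed.

Lemma poly_sectionD F G : poly_section (F + G) = poly_section F + poly_section G.
Proof. by apply/polyP => k; rewrite coefD !coef_poly_section coefD raddfD. Qed.

(** In characteristic [p] the power is [Y^p - f^p]. The factor [Y^p] leaves the section as [Y], and
    [f^p] leaves it as [f] by semilinearity of [L]. *)
Lemma poly_section_XsubC_exp f F :
  poly_section (('X - f%:P) ^+ p * F) = ('X - f%:P) * poly_section F.
Proof.
have charPp : p \in [pchar {poly R}] by rewrite (rmorph_pchar (polyC : {rmorphism R -> {poly R}})).
rewrite -(pFrobenius_autE charPp) pFrobenius_autB_comm ?pFrobenius_autE; last exact: mulrC.
rewrite -polyC_exp !mulrBl; apply/polyP => k.
rewrite coef_poly_section !coefB !coefCM coefXnM coefXM raddfB /= L_semilinear -coef_poly_section.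
congr (_ - _); case: k => [|k]; first by rewrite muln0 add0n prednK // leqnn raddf0.
rewrite ltnNge mulnS -addnA leq_addr /= coef_poly_section.
by rewrite addnC addnK.
Qed.

(** The power is monic of degree [p - 1], hence only its leading term is seen by the section. *)
Lemma poly_section_XsubC_pred f c :
  poly_section (('X - f%:P) ^+ p.-1 * c%:P) = (L c)%:P.
Proof.
have sz : size (('X - f%:P) ^+ p.-1) = p by rewrite size_exp_XsubC prednK.
apply/polyP => k; rewrite coef_poly_section coefMC coefC.
case: k => [|k] /=; last first.
  by rewrite nth_default ?mul0r ?raddf0 // sz mulnS -addnA leq_addr.
have /monicP : ('X - f%:P) ^+ p.-1 \is monic by rewrite monic_exp // monicXsubC.
by rewrite /lead_coef sz muln0 add0n => ->; rewrite mul1r.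
Qed.

(* Write P = (Y - f) Q, so that P'(f) = Q(f). Modulo (Y - f)^p, which factors
   through the section as Y - f, the product S P^(p-1) is the monic polynomial
   (Y - f)^(p-1) times the constant S(f) Q(f)^(p-1) = w Q(f)^p. *)
Lemma section_quotient P S f w : P.[f] = 0 -> w * P^`().[f] = S.[f] ->
  L w * P^`().[f] = (poly_section (S * P ^+ p.-1)).[f].
Proof.
move=> /eqP /factor_theorem[Q ->]; rewrite derivM derivXsubC mulr1 hornerD.
rewrite hornerM hornerXsubC subrr mulr0 add0r => wS.
have /factor_theorem[T eT] : root (S * Q ^+ p.-1 - (S * Q ^+ p.-1).[f]%:P) f.
  by apply/rootP; rewrite hornerD hornerN hornerC subrr.
have [c ec {}eT] : exists2 c, c = w * Q.[f] ^+ p & S * Q ^+ p.-1 = T * ('X - f%:P) + c%:P.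
  exists (S * Q ^+ p.-1).[f]; last by rewrite -eT subrK.
  by rewrite hornerM -wS horner_exp -mulrA -exprS prednK.
have -> : S * (Q * ('X - f%:P)) ^+ p.-1 =
    ('X - f%:P) ^+ p * T + ('X - f%:P) ^+ p.-1 * c%:P.
  have -> : ('X - f%:P) ^+ p = ('X - f%:P) * ('X - f%:P) ^+ p.-1 by rewrite -exprS prednK.
  rewrite exprMn mulrA eT mulrDl; congr (_ + _); last exact: mulrC.
  by rewrite -[LHS]mulrA [RHS]mulrC.
rewrite poly_sectionD poly_section_XsubC_exp poly_section_XsubC_pred hornerD hornerC.
rewrite hornerM hornerXsubC subrr mul0r add0r ec.
by rewrite mulrC [w * _]mulrC L_semilinear.
Qed.

End SectionOperator.

Section Cartier.
Variables (n p : nat) (F : fieldType).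
Implicit Types (f a b : series n F) (r m : 'X_{1..n}).

(** Over the prime field Frobenius fixes the constants, so no p-th root of the coefficients is
    taken. *)
Definition cartier r f : series n F := fun m => f (m *+ p + r)%MM.

Lemma cartierE r f m : cartier r f m = f (m *+ p + r)%MM.
Proof. by []. Qed.

Lemma cartier_is_additive r : zmod_morphism (cartier r).
Proof. by move=> f g; apply/seriesP => m; rewrite !(serD, serN, cartierE). Qed.

HB.instance Definition _ r := GRing.isZmodMorphism.Build
  (series n F) (series n F) (cartier r) (cartier_is_additive r).

Lemma cartierD r f g : cartier r (f + g) = cartier r f + cartier r g.
Proof. exact: raddfD. Qed.

Lemma cartier0 r : cartier r 0 = 0.
Proof. exact: raddf0. Qed.

Lemma low_mul D a b m : (forall k, (mdeg k < D)%N -> a k = 0) ->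
  (mdeg m < D)%N -> (a * b) m = 0.
Proof.
move=> a0 mD; rewrite serM big1 // => k _.
by rewrite a0 ?mul0r //; apply: leq_trans (bmdeg k) mD.
Qed.

Definition small r := forall i, (r i < p)%N.

Hypothesis charFp : p \in [pchar F].
(** This says that [F] is a prime field: additive statements about polynomials then reduce to
    monomials with coefficient 1. *)
Hypothesis F_prime : forall c : F, exists k : nat, c = k%:R.

Let p_gt0 : (0 < p)%N. Proof. exact/prime_gt0/(pcharf_prime charFp). Qed.

Lemma pchar_series : p \in [pchar (series n F)].
Proof.
rewrite inE (pcharf_prime charFp) /= -(rmorph_nat (@ser_of_mpoly n F)) -mpolyC_nat.
by rewrite (pcharf0 charFp) mpolyC0 rmorph0.
Qed.

Lemma cartier_monomial r k b : small r ->
  cartier r (serX F k ^+ p * b) = serX F k * cartier r b.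
Proof.
move=> rp; apply/seriesP => m; rewrite /cartier.
have -> : serX F k ^+ p = serX F (k *+ p) by rewrite -rmorphXn mpolyXn.
rewrite !serXM; have -> : (k *+ p <= m *+ p + r)%MM = (k <= m)%MM.
  apply/mnm_lepP/mnm_lepP => km i; move: (km i) (rp i); rewrite mnmDE !mulmnE.
    by move=> h1 h2; rewrite leqNgt; apply/negP => h3; nia.
  by nia.
case: ifP => // /mnm_lepP km; congr b; apply/mnmP => i; move: (km i).
rewrite !(mnmDE, mnmBE, mulmnE) => h; rewrite mulnBl addnBAC //.
by rewrite leq_mul2r h orbT.
Qed.

(** Both sides are additive in [a] because Frobenius is, so the monomial case gives all polynomials.
    For a general [a], each coefficient of the identity involves only a truncation of [a]. *)
Lemma cartier_semilinear r a b : small r ->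
  cartier r (a ^+ p * b) = a * cartier r b.
Proof.
move=> rp.
pose good a := forall b, cartier r (a ^+ p * b) = a * cartier r b.
have goodD a1 a2 : good a1 -> good a2 -> good (a1 + a2).
  move=> g1 g2 c; rewrite -(pFrobenius_autE pchar_series) rmorphD /= !pFrobenius_autE.
  by rewrite (mulrDl (a1 ^+ p)) (mulrDl a1) cartierD g1 g2.
have good0 : good 0 by move=> c; rewrite expr0n gtn_eqF // !mul0r cartier0.
have goodMn a1 k : good a1 -> good (a1 *+ k).
  by move=> g1; elim: k => [|k IH]; rewrite ?mulr0n // mulrS; apply: goodD.
have goodT D : good (ser_of_mpoly (trunc D a)).
  rewrite /trunc rmorph_sum; elim/big_rec: _ => // k y _ gy; apply: goodD => //.
  have [j ->] := F_prime (a k); rewrite scaler_nat.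
  by rewrite rmorphMn; apply: goodMn => c; apply: cartier_monomial.
(* The left side is read at [M] and the right side at [m], whose degree is at most that of [M]; with
   [D] above both, the tail [a - t] contributes to neither side. *)
apply/seriesP => m; set M := (m *+ p + r)%MM; set D := (mdeg M).+1.
set t := ser_of_mpoly (trunc D a).
have lowt k : (mdeg k < D)%N -> (a - t) k = 0.
  by move=> kD; rewrite serD serN /t ser_of_mpolyE mcoeff_trunc // subrr.
have -> : a = (a - t) + t by rewrite subrK.
rewrite -(pFrobenius_autE pchar_series) rmorphD /= !pFrobenius_autE.
rewrite (mulrDl ((a - t) ^+ p)) (mulrDl (a - t)) cartierD goodT !serD.
congr (_ + _); rewrite [RHS](low_mul _ lowt); last by rewrite ltnS mdegD mdegMn; nia.
by rewrite cartierE -(prednK p_gt0) exprS -mulrA [LHS](low_mul _ lowt) // prednK.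
Qed.

Lemma deg_le_cartier h r f : deg_le (h * p) f -> deg_le h (cartier r f).
Proof.
move=> fh m mh; apply: fh; rewrite mdegD mdegMn.
by apply: ltn_addr; rewrite ltn_pmul2r.
Qed.

End Cartier.

(** * Diagonals and Cartier operators in one variable *)

Section Diagonal.
Variables (n : nat) (R : comNzRingType).

Definition diag (f : series n R) : series 1 R := diagonal f.

Lemma diag_is_additive : zmod_morphism diag.
Proof. by move=> f g; apply/seriesP => m; rewrite /diag /diagonal !(serD, serN). Qed.

HB.instance Definition _ := GRing.isZmodMorphism.Build
  (series n R) (series 1 R) diag diag_is_additive.

End Diagonal.

Section UnivariateDecomposition.
Variables (p : nat) (F : fieldType).
Hypothesis charFp : p \in [pchar F].
Hypothesis F_prime : forall c : F, exists k : nat, c = k%:R.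

Definition cst (n i : nat) : 'X_{1..n} := [multinom i | _ < n].

(** Both sides read [f] at the constant exponent [p * m + i]. *)
Lemma diag_cartier n (f : series n F) i :
  diag (cartier p (cst n i) f) = cartier p (cst 1 i) (diag f).
Proof.
apply/seriesP => m; rewrite /diag /cartier /diagonal; congr f.
by apply/mnmP => j; rewrite !(mnmE, mnmDE, mulmnE).
Qed.

Lemma small_cst n i : (i < p)%N -> small p (cst n i).
Proof. by move=> ip j; rewrite mnmE. Qed.

Definition var : series 1 F := serX F (cst 1 1).

Lemma varX i : var ^+ i = serX F (cst 1 i).
Proof.
rewrite /var /serX -rmorphXn mpolyXn; congr (ser_of_mpoly 'X_[_]).
by apply/mnmP => j; rewrite mulmnE !mnmE mul1n.
Qed.

(** The exponents are sorted by their residue [i] modulo [p]; over the prime field each class is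
    [x^i] times a p-th power. *)
Lemma cartier_decomposition (v : series 1 F) :
  v = \sum_(i < p) var ^+ i * cartier p (cst 1 i) v ^+ p.
Proof.
have p_gt0 := prime_gt0 (pcharf_prime charFp).
have powE (w : series 1 F) m : (w ^+ p) m = if (p %| m ord0)%N then w (cst 1 (m ord0 %/ p)) else 0.
  pose q := (m ord0 %/ p)%N; pose s := (m ord0 %% p)%N.
  have sp : (s < p)%N by rewrite ltn_mod.
  have em : m = (cst 1 q *+ p + cst 1 s)%MM.
    by apply/mnmP => j; rewrite (ord1 j) mnmDE mulmnE !mnmE -divn_eq.
  (* The coefficients of [w ^+ p] come from semilinearity applied to [w ^+ p * 1], as the section of
     1 of residue [s] is 1 for [s = 0] and 0 otherwise. *)
  transitivity ((w * cartier p (cst 1 s) 1) (cst 1 q)).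
    by rewrite -(cartier_semilinear charFp F_prime _ _ (@small_cst 1 _ sp)) mulr1 /cartier -em.
  have -> : cartier p (cst 1 s) 1 = (s == 0%N)%:R :> series 1 F.
    apply/seriesP => k; rewrite cartierE ser1E mnmD_eq0.
    have -> : (cst 1 s == 0%MM) = (s == 0%N).
      by apply/eqP/eqP => [/mnmP /(_ ord0)|->]; [rewrite !mnmE|apply/mnmP => j; rewrite !mnmE].
    case: (s == 0%N); rewrite ?andbF ?andbT //= mulr1n ser1E.
    by rewrite -!mdeg_eq0 mdegMn muln_eq0 (gtn_eqF p_gt0) orbF.
  rewrite /dvdn -/s; case: (s == 0%N); first by rewrite mulr1.
  by rewrite mulr0.
apply/seriesP => m; rewrite ser_sum; set d := m ord0.
have sp : (d %% p < p)%N by rewrite ltn_mod.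
rewrite (bigD1 (Ordinal sp)) //= big1 ?addr0.
  rewrite varX serXM; have -> : (cst 1 (d %% p) <= m)%MM.
    by apply/mnm_lepP => j; rewrite (ord1 j) mnmE leq_mod.
  rewrite powE mnmBE mnmE -/d.
  have -> : (d - d %% p = d %/ p * p)%N by rewrite {1}(divn_eq d p) addnK.
  rewrite dvdn_mull // mulnK // /cartier; congr v; apply/mnmP => j.
  by rewrite (ord1 j) mnmDE mulmnE !mnmE -divn_eq.
move=> i; rewrite -val_eqE /= => ine; rewrite varX serXM; case: ifP => // /mnm_lepP /(_ ord0).
rewrite mnmE -/d => id; rewrite powE mnmBE mnmE -/d; case: ifP => // pd.
case/eqP: ine; apply/esym; rewrite -[in LHS](subnK id) -modnDml (eqP pd) add0n modn_small //.
Qed.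

End UnivariateDecomposition.

(** * Equations for the diagonal in characteristic p *)

Section Pigeonhole.
Variables (p : nat) (F : finFieldType) (n d h : nat).
Hypothesis charFp : p \in [pchar F].
Hypothesis F_prime : forall c : F, exists k : nat, c = k%:R.
Hypothesis cardF : #|F| = p.
Variables (f : series n F) (P : {poly series n F}).
Hypothesis sizeP : (size P <= d.+1)%N.
Hypothesis coefsP : coefs_le h P.
Hypothesis rootPf : P.[f] = 0.
Hypothesis sep : P^`().[f] != 0.

Let p_prime : prime p. Proof. exact: pcharf_prime charFp. Qed.
Let p_gt1 : (1 < p)%N. Proof. exact: prime_gt1. Qed.
Let p_gt0 : (0 < p)%N. Proof. exact: prime_gt0. Qed.

(** [S] witnesses that [w] lies in the space [W]; the common denominator is the derivative of [P] at
    [f]. *)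
Definition numerator (w : series n F) (S : {poly series n F}) :=
  [/\ (size S <= d.+1)%N, coefs_le h S & w * P^`().[f] = S.[f]].

Lemma numerator0 : numerator 0 0.
Proof.
split; rewrite ?size_poly0 //; last by rewrite mul0r horner0.
by move=> i; rewrite coef0.
Qed.

Lemma numeratorD w1 w2 S1 S2 :
  numerator w1 S1 -> numerator w2 S2 -> numerator (w1 + w2) (S1 + S2).
Proof.
move=> [s1 c1 e1] [s2 c2 e2]; split.
- by apply: leq_trans (size_polyD _ _) _; rewrite geq_max s1.
- exact: coefs_leD.
- by rewrite mulrDl e1 e2 hornerD.
Qed.

(** Multiplying by [Y] restores the degree lost by differentiation, so the bound [d] is kept. *)
Lemma numerator_root : numerator f ('X * P^`()).
Proof.
split; last by rewrite hornerM hornerX.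
- have := size_polyMleq 'X P^`(); rewrite size_polyX => /leq_trans; apply.
  have Pn0 : P != 0 by apply: contraNneq sep => ->; rewrite deriv0 horner0.
  exact: leq_trans (lt_size_deriv Pn0) sizeP.
- by rewrite -[h]add0n; apply: coefs_leM; [exact: coefs_leX|exact: coefs_le_deriv].
Qed.

(** The product [S * P ^+ p.-1] has degree at most [d * p] in [Y] and height at most [h * p]. The
    section brings these bounds back to [d] and [h]. *)
Lemma numerator_cartier w S r : small p r -> numerator w S ->
  numerator (cartier p r w) (poly_section p (cartier p r) (S * P ^+ p.-1)).
Proof.
move=> rp [sS cS eS].
have charS := pchar_series n charFp.
have semilin (a b : series n F) : cartier p r (a ^+ p * b) = a * cartier p r b.
  exact: (cartier_semilinear charFp F_prime).
split; last exact: (section_quotient charS).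
- apply/leq_sizeP => k dk; rewrite (coef_poly_section _ charS) nth_default ?cartier0 //.
  apply: leq_trans (size_polyMleq _ _) _.
  have := size_poly_exp_leq P p.-1; move: sS sizeP dk p_gt1.
  set e := size (P ^+ _); move=> h1 h2 h3 _ h5.
  have h6 : ((size P).-1 * p.-1 <= d * p.-1)%N by rewrite leq_mul2r; apply/orP; right; lia.
  have h7 : (p * d.+1 <= p * k)%N by rewrite leq_mul2l h3 orbT.
  have h8 : (p * d.+1 = d * p.-1 + d + p)%N by rewrite mulnS -{1}(prednK p_gt0); lia.
  clear -h1 h5 h6 h7 h8 p_gt0; clearbody e; move: (size S) h1 h5 h6 h7 h8 p_gt0 => s h1 h5 h6 h7 h8 h9; move: h1 h5 h6 h7 h8 h9; move: ((size P).-1 * p.-1)%N (d * p.-1)%N (p * k)%N (p * d.+1)%N => x y z t.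
  move=> *; lia.
- move=> k; rewrite (coef_poly_section _ charS); apply: deg_le_cartier => //.
  have := coefs_leM cS (@coefs_le_exp _ _ _ _ p.-1 coefsP).
  by rewrite -mulnS prednK //; apply.
Qed.


Definition in_W w := exists S, numerator w S.

(** The combinations of the [x^j], [j < M], whose coefficients are [p^k]-th powers of elements of
    the diagonal of [W]. They are closed under sums because Frobenius is additive. *)
Definition frob_span k M (u : series 1 F) := exists2 w : nat -> series n F,
  (forall j, in_W (w j)) & u = \sum_(j < M) var F ^+ j * diag (w j) ^+ (p ^ k).

Lemma exp_frobD n' (a b : series n' F) k :
  (a + b) ^+ (p ^ k) = a ^+ (p ^ k) + b ^+ (p ^ k).
Proof.
apply: exprDn_pchar; rewrite pnatX; apply/orP; left.
by rewrite pnatE // pchar_series.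
Qed.

Lemma frob_spanD k M u v :
  frob_span k M u -> frob_span k M v -> frob_span k M (u + v).
Proof.
move=> [w1 W1 ->] [w2 W2 ->]; exists (fun j => w1 j + w2 j).
  move=> j; have [[S1 h1] [S2 h2]] := (W1 j, W2 j).
  by exists (S1 + S2); apply: numeratorD.
rewrite -big_split; apply: eq_bigr => j _ /=.
by rewrite [diag (_ + _)]raddfD exp_frobD mulrDr.
Qed.

Lemma frob_span_monomial k M w j : in_W w -> (j < M)%N ->
  frob_span k M (var F ^+ j * diag w ^+ (p ^ k)).
Proof.
move=> Ww jM; exists (fun i => if i == j then w else 0).
  by move=> i; case: ifP => // _; exists 0; apply: numerator0.
rewrite (bigD1 (Ordinal jM)) //= eqxx big1 ?addr0 // => i.
rewrite -val_eqE /= => /negPf ->.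
by rewrite [diag 0]raddf0 expr0n expn_eq0 (gtn_eqF p_gt0) mulr0.
Qed.

Lemma frob_span0 k M : frob_span k M 0.
Proof.
exists (fun=> 0); first by move=> i; exists 0; apply: numerator0.
rewrite big1 // => i _.
by rewrite [diag 0]raddf0 expr0n expn_eq0 (gtn_eqF p_gt0) mulr0.
Qed.

Lemma frob_span_sum k M I (r : seq I) (Q : pred I) (u : I -> series 1 F) :
  (forall i, Q i -> frob_span k M (u i)) -> frob_span k M (\sum_(i <- r | Q i) u i).
Proof.
move=> Qu; elim/big_rec: _ => [|i y Qi]; first exact: frob_span0.
by apply: frob_spanD; apply: Qu.
Qed.

Lemma frob_spanMn k M u c : frob_span k M u -> frob_span k M (u *+ c).
Proof.
move=> uM; elim: c => [|c IH]; first exact: frob_span0.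
by rewrite mulrS; apply: frob_spanD.
Qed.

Lemma exp_frob_sum k I (r : seq I) (u : I -> series 1 F) :
  (\sum_(i <- r) u i) ^+ (p ^ k) = \sum_(i <- r) u i ^+ (p ^ k).
Proof.
elim/big_rec2: _ => [|i x y _ <-]; last by rewrite exp_frobD.
by rewrite expr0n expn_eq0 (gtn_eqF p_gt0).
Qed.

(** Splitting [diag w] by residues turns [x^j * v^(p^k)] into terms
    [x^(j + i * p^k) * v_i^(p^(k+1))] with [i < p]. After [l] rounds the exponent of [x] has grown
    by at most [p^(k+l) - p^k], which is what the hypothesis allows. *)
Lemma frob_span_refine l k j M w : in_W w -> (j + p ^ (k + l) < M + p ^ k)%N ->
  frob_span (k + l) M (var F ^+ j * diag w ^+ (p ^ k)).
Proof.
elim: l k j w => [|l IH] k j w Ww.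
  by rewrite addn0 ltn_add2r => jM; apply: frob_span_monomial.
rewrite -addSnnS => jM.
rewrite [diag w](cartier_decomposition charFp F_prime) exp_frob_sum mulr_sumr.
apply: frob_span_sum => i _; have [S nS] := Ww.
rewrite -diag_cartier exprMn mulrA -!exprM -exprD -expnS; apply: IH.
  exists (poly_section p (cartier p (cst n i)) (S * P ^+ p.-1)).
  by apply: numerator_cartier nS; apply: small_cst.
move: (ltn_ord i) jM; rewrite -[(p ^ k.+1)%N]/(p ^ (0 + k.+1))%N add0n [(p ^ k.+1)%N]expnS.
move: (p ^ (k.+1 + l))%N (p ^ k)%N => x y ip; have : (i.+1 * y <= p * y)%N by rewrite leq_mul2r ip orbT.
nia.
Qed.

(** [N] counts the coefficients of a numerator, [D] bounds the degree in [x] of the relation sought,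
    and [M] is the length of the Frobenius expansions. The choice [D = N * p ^ N] makes the final
    count succeed. *)
Let N := (d.+1 * h.+1 ^ n)%N.
Let D := (N * p ^ N)%N.
Let M := (D + p ^ N)%N.
Let index := ('I_N.+1 * 'I_D.+1)%type.
Let box := ('I_d.+1 * {ffun 'I_n -> 'I_h.+1})%type.
Let code_type := {ffun box -> F}.

(** Only p-power exponents of [Y] occur, so that the value at [diag f] has a Frobenius expansion. *)
Definition relation_poly (b : {ffun index -> F}) : {poly {mpoly F[1]}} :=
  \sum_(k < N.+1) (\sum_(i < D.+1) b (k, i) *: 'X_[cst 1 i]) *: 'X^(p ^ k).

Lemma relation_poly_span b :
  frob_span N M (map_poly (@ser_of_mpoly 1 F) (relation_poly b)).[diag f].
Proof.
rewrite /relation_poly rmorph_sum horner_sum; apply: frob_span_sum => k _.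
rewrite /= map_polyZ map_polyXn hornerZ hornerXn rmorph_sum mulr_suml.
apply: frob_span_sum => i _; have [c ->] := F_prime (b (k, i)).
rewrite scaler_nat rmorphMn mulrnAl; apply: frob_spanMn.
rewrite /=; have -> : ser_of_mpoly 'X_[cst 1 i] = var F ^+ i by rewrite varX.
have kN : (k + (N - k) = N)%N by rewrite subnKC // -ltnS.
rewrite -[in frob_span N]kN; apply: frob_span_refine.
  by exists ('X * P^`()); apply: numerator_root.
(* The condition for refinement becomes [i < D + p ^ k], which holds since [i <= D]. *)
rewrite kN /M addnAC ltn_add2r -addn1 leq_add //; first by rewrite -ltnS.
by rewrite expn_gt0 p_gt0.
Qed.

Lemma coef_relation_poly b (k : 'I_N.+1) (i : 'I_D.+1) :
  ((relation_poly b)`_(p ^ k))@_(cst 1 i) = b (k, i).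
Proof.
rewrite /relation_poly coef_sum (bigD1 k) //= [X in _ + X]big1 ?addr0; last first.
  move=> j jk; rewrite coefZ coefXn eqn_exp2l // eq_sym -[_ == _]/(j == k).
  by rewrite (negPf jk) mulr0.
rewrite coefZ coefXn eqxx mulr1 raddf_sum (bigD1 i) //= big1 ?addr0; last first.
  move=> j ji; rewrite mcoeffZ mcoeffX; case: eqP => [/mnmP /(_ ord0)|]; rewrite ?mulr0 //.
  by rewrite !mnmE => /val_inj e; rewrite e eqxx in ji.
by rewrite mcoeffZ mcoeffX eqxx mulr1.
Qed.

Lemma size_relation_poly b : (size (relation_poly b) <= (p ^ N).+1)%N.
Proof.
apply: leq_trans (size_sum _ _ _) _; apply/bigmax_leqP => k _.
apply: leq_trans (size_scale_leq _ _) _.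
by rewrite size_polyXn ltnS leq_exp2l // -ltnS.
Qed.

Lemma msize_relation_poly b i : (msize (relation_poly b)`_i <= D.+1)%N.
Proof.
rewrite /relation_poly coef_sum; apply: leq_trans (msize_sum _ _ _) _.
apply/bigmax_leqP => k _; rewrite coefZ coefXn; case: eqP => _; last first.
  by rewrite mulr0 msize0.
rewrite mulr1; apply: leq_trans (msize_sum _ _ _) _; apply/bigmax_leqP => j _.
apply: leq_trans (mmeasureZ_le _ _ _) _; rewrite msizeX mdegE.
by rewrite big_ord_recl big_ord0 addn0 mnmE.
Qed.

(** Each exponent is bounded by [h] separately: this box contains all exponents of total degree at
    most [h] and is easy to count. *)
Definition code (S : {poly series n F}) : code_type :=
  [ffun x : box => S`_x.1 [multinom (x.2 i : nat) | i < n]].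

Lemma code_inj (S S' : {poly series n F}) : (size S <= d.+1)%N -> (size S' <= d.+1)%N ->
  coefs_le h S -> coefs_le h S' -> code S = code S' -> S = S'.
Proof.
move=> sS sS' cS cS' /ffunP e; apply/polyP => k.
have [kd|dk] := ltnP k d.+1; last by rewrite !nth_default // (leq_trans _ dk).
apply/seriesP => m; have [mh|hm] := leqP (mdeg m) h; last by rewrite cS ?cS'.
have mi i : (m i < h.+1)%N.
  by rewrite ltnS (leq_trans _ mh) // mdegE (bigD1 i) //= leq_addr.
have := e (Ordinal kd, [ffun i => Ordinal (mi i)]); rewrite !ffunE /=.
suff -> : [multinom ([ffun i => Ordinal (mi i)] i : nat) | i < n] = m by [].
by apply/mnmP => i; rewrite mnmE ffunE.
Qed.

Lemma diagonal_relation : exists Q : {poly {mpoly F[1]}},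
  [/\ Q != 0, (size Q <= (p ^ N).+1)%N, forall i, (msize Q`_i <= D.+1)%N
    & (map_poly (@ser_of_mpoly 1 F) Q).[diag f] = 0].
Proof.
pose value b := (map_poly (@ser_of_mpoly 1 F) (relation_poly b)).[diag f].
(* A code of [u] records the numerators in some Frobenius expansion of [u]; it is a point of a
   finite set. *)
pose coded (u : series 1 F) (phi : {ffun 'I_M -> code_type}) :=
  exists w S, [/\ forall j, numerator (w j) (S j),
    u = \sum_(j < M) var F ^+ j * diag (w j) ^+ (p ^ N)
    & forall j : 'I_M, phi j = code (S j)].
have coded_fun u u' phi : coded u phi -> coded u' phi -> u = u'.
  move=> [w [S [nS -> eS]]] [w' [S' [nS' -> eS']]]; apply: eq_bigr => j _.
  have [[s1 c1 e1] [s2 c2 e2]] := (nS j, nS' j).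
  have eqS : S j = S' j by apply: code_inj => //; rewrite -eS -eS'.
  (* The derivative of [P] at [f] is nonzero, so a numerator determines its quotient. *)
  suff -> : w j = w' j by [].
  by apply: (ser_mulIf sep); rewrite /= e1 e2 eqS.
have ex_code b : exists phi, coded (value b) phi.
  rewrite /value; have [w Ww ->] := relation_poly_span b.
  have [S nS] := boolp.choice Ww.
  by exists [ffun j : 'I_M => code (S j)], w, S; split=> // j; rewrite ffunE.
have [Phi ePhi] := boolp.choice ex_code.
(* There are [p ^ ((N + 1) * (D + 1))] families [b] and [p ^ (N * M)] codes. Since
   [N * M = N * D + N * p ^ N = N * D + D], the former are more numerous. *)
have /injectivePn[b1 [b2 b12 eb]] : ~~ injectiveb Phi.
  apply/injectiveP => /leq_card; rewrite !card_ffun !card_prod !card_ffun !card_ord cardF.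
  rewrite -/N -expnM leq_exp2l // leqNgt /M mulnDr -/D mulSn mulnS.
  lia.
exists (relation_poly b1 - relation_poly b2); split.
- rewrite subr_eq0; apply: contra b12 => /eqP e; apply/eqP/ffunP => -[k i].
  by rewrite -!coef_relation_poly e.
- apply: leq_trans (size_polyD _ _) _.
  by rewrite size_polyN geq_max !size_relation_poly.
- move=> i; rewrite coefB; apply: leq_trans (msizeD_le _ _) _.
  by rewrite msizeN geq_max !msize_relation_poly.
- rewrite rmorphB hornerD hornerN; apply/eqP; rewrite subr_eq0; apply/eqP.
  apply: (coded_fun _ _ (Phi b1)); first exact: ePhi.
  by rewrite eb; apply: ePhi.
Qed.

End Pigeonhole.

(** * Descent to an equation with nonzero derivative *)

Section Separability.
Variables (p : nat) (F : fieldType) (n h : nat).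
Hypothesis charFp : p \in [pchar F].
Hypothesis F_prime : forall c : F, exists k : nat, c = k%:R.
Variable f : series n F.

Let p_gt1 : (1 < p)%N. Proof. exact: prime_gt1 (pcharf_prime charFp). Qed.
Let p_gt0 : (0 < p)%N. Proof. exact: ltnW. Qed.

(** A coefficient of index [k] is killed by the factor [k] only if [p] divides [k], so only powers
    of [Y^p] remain. *)
Lemma deriv_eq0_comp_Xp (P : {poly series n F}) : P^`() = 0 ->
  P = (\poly_(i < size P) P`_(p * i)) \Po 'X^p.
Proof.
move=> P0; apply/polyP => k; rewrite coef_comp_poly_Xn //.
case: ifP => [/dvdnP[i ->]|ndvd].
  rewrite mulnK // coef_poly mulnC; case: ltnP => // iP; apply: nth_default.
  by rewrite (leq_trans iP) // leq_pmull.
case: k ndvd => [|k] ndvd; first by rewrite dvdn0 in ndvd.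
have /eqP := congr1 (fun Q : {poly series n F} => Q`_k) P0.
rewrite coef_deriv coef0 -mulr_natl => /eqP /ser_mulf_eq0 /orP[|/eqP //].
by rewrite -(dvdn_pcharf (pchar_series n charFp)) ndvd.
Qed.

(** Here [P(f)] is a sum of terms [P_(p i) * (f^i)^p], from which the powers [f^i] leave the
    operator by semilinearity. *)
Lemma cartier_annihilator (P : {poly series n F}) (r : 'X_{1..n}) : small p r ->
  P^`() = 0 -> (\poly_(i < size P) cartier p r P`_(p * i)).[f] = cartier p r P.[f].
Proof.
move=> rp P0; rewrite [in RHS](deriv_eq0_comp_Xp P0) horner_comp hornerXn.
rewrite !horner_poly raddf_sum; apply: eq_bigr => i _ /=.
by rewrite exprAC [in RHS]mulrC (cartier_semilinear charFp F_prime) // mulrC.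
Qed.

(** Induction on the degree in [Y]. If the derivative is nonzero but vanishes at [f], it is a
    smaller equation; if it is zero, a suitable Cartier operator divides the degree by [p]. The
    height never grows. *)
Lemma separable_annihilator (P : {poly series n F}) :
  P != 0 -> coefs_le h P -> P.[f] = 0 ->
  exists Q : {poly series n F}, [/\ (size Q <= size P)%N, coefs_le h Q,
    Q.[f] = 0 & Q^`().[f] != 0].
Proof.
have [m] := ubnP (size P); elim: m P => // m IH P; rewrite ltnS => Pm Pn0 cP Pf.
have [dPf|dPf] := eqVneq P^`().[f] 0; last by exists P.
have step (Q : {poly series n F}) : Q != 0 -> (size Q < size P)%N -> coefs_le h Q ->
    Q.[f] = 0 -> exists Q : {poly series n F}, [/\ (size Q <= size P)%N, coefs_le h Q,
    Q.[f] = 0 & Q^`().[f] != 0].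
  move=> Qn0 QP cQ Qf; have [Q' [sQ' cQ' Q'f dQ']] := IH Q (leq_trans QP Pm) Qn0 cQ Qf.
  by exists Q'; split=> //; apply: leq_trans sQ' (ltnW QP).
have [dP0|dPn0] := eqVneq P^`() 0; last first.
  exact: (step P^`() dPn0 (lt_size_deriv Pn0) (coefs_le_deriv cP)).
have lPn0 : lead_coef P != 0 by rewrite lead_coef_eq0.
have [j ej] : exists j, (size P).-1 = (p * j)%N.
  move: lPn0; rewrite /lead_coef [P in X in P`_X](deriv_eq0_comp_Xp dP0).
  rewrite {1}(deriv_eq0_comp_Xp dP0) coef_comp_poly_Xn // -(deriv_eq0_comp_Xp dP0).
  by case: ifP => [/dvdnP[j ->] _|_ /eqP//]; exists j; rewrite mulnC.
have sPj : size P = (p * j).+1 by rewrite -ej prednK // size_poly_gt0.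
(* For [j = 0] the polynomial would be a nonzero constant, which cannot vanish at [f]. *)
have j_gt0 : (0 < j)%N.
  rewrite lt0n; apply: contraNneq lPn0 => j0; move: sPj; rewrite j0 muln0 => sP1.
  by rewrite -Pf (size1_polyC (eq_leq sP1)) hornerC lead_coefC.
have [m0 Pm0] : exists m0, lead_coef P m0 != 0.
  apply: boolp.contrapT => /boolp.forallNP nz; case/eqP: lPn0; apply/seriesP => k.
  by move: (nz k) => /negP; rewrite negbK => /eqP.
(* This residue keeps the coefficient of the leading coefficient at [m0], so the new equation is
   nonzero. *)
pose r := [multinom (m0 i %% p)%N | i < n].
have rp : small p r by move=> i; rewrite mnmE ltn_mod.
apply: (step (\poly_(i < size P) cartier p r P`_(p * i))).
- apply: contraNneq Pm0 => /(congr1 (fun Q : {poly series n F} => Q`_j)).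
  rewrite coef_poly coef0 sPj ltnS leq_pmull // -ej => /seriesP /(_ [multinom (m0 i %/ p)%N | i < n]).
  rewrite cartierE ser0E -/(lead_coef P) => /eqP; congr (lead_coef P _ == 0).
  by apply/mnmP => i; rewrite mnmDE mulmnE !mnmE -divn_eq.
- apply: (@leq_ltn_trans j.+1); last by rewrite sPj ltnS -[X in (X < _)%N]mul1n ltn_pmul2r.
  apply/leq_sizeP => i ji; rewrite coef_poly; case: ifP => // _.
  by rewrite nth_default ?cartier0 // sPj ltn_pmul2l.
- move=> i; rewrite coef_poly; case: ifP => // _; apply: deg_le_cartier => //.
  by apply: deg_leW (cP _); rewrite leq_pmulr.
- by rewrite cartier_annihilator // Pf cartier0.
Qed.

End Separability.

Lemma ex_least (S : nat -> Prop) m : S m -> exists2 e, is_least S e & (e <= m)%N.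
Proof.
elim/ltn_ind: m => m IH Sm.
have [[k km Sk]|nk] := boolp.pselect (exists2 k, (k < m)%N & S k).
  by have [e le ek] := IH k km Sk; exists e => //; apply: leq_trans (ltnW km).
exists m => //; split=> // k Sk; rewrite leqNgt; apply/negP => km.
by apply: nk; exists k.
Qed.

(** One polynomial satisfying both bounds suffices; the least degree and the least height exist
    because [nat] is well-founded. *)
Lemma algebraic_boundedI n (K : fieldType) (g : pseries n K) d h P :
  annihilates P g -> (size P <= d.+1)%N -> (poly_height P <= h)%N ->
  algebraic_bounded g d h.
Proof.
move=> Pg sP hP; split; first by exists P.
  by apply: ex_least; exists P.
have [e le eh] := @ex_least (fun m => exists2 P, annihilates P g & poly_height P = m)
  _ (ex_intro2 _ _ P Pg erefl).
by exists e => //; apply: leq_trans hP.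
Qed.

Lemma diagonal_bounded p (F : finFieldType) n d h (f : series n F)
    (P : {poly {mpoly F[n]}}) :
  p \in [pchar F] -> #|F| = p -> (forall c : F, exists k : nat, c = k%:R) ->
  annihilates P f -> (size P <= d.+1)%N -> (forall i, msize P`_i <= h.+1)%N ->
  let N := (d.+1 * h.+1 ^ n)%N in
  algebraic_bounded (diagonal f) (p ^ N) (N * p ^ N).
Proof.
move=> charFp cardF F_prime [Pn0 Pf] sP hP N.
pose Q := map_poly (@ser_of_mpoly n F) P.
have Qn0 : Q != 0 by rewrite map_poly_eq0_id0 // (raddf_eq0 _ (@ser_of_mpoly_inj n F)) lead_coef_eq0.
have cQ : coefs_le h Q by move=> i; rewrite coef_map /=; apply/deg_leP; exists P`_i.
have Qf : Q.[f] = 0 by rewrite -ps_evalE; apply/seriesP.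
have [Q' [sQ' cQ' Q'f dQ']] := separable_annihilator charFp F_prime Qn0 cQ Qf.
have sQ'd : (size Q' <= d.+1)%N.
  by apply: leq_trans sQ' (leq_trans (size_poly _ _) sP).
have [B [Bn0 sB hB Bf]] := diagonal_relation charFp F_prime cardF sQ'd cQ' Q'f dQ'.
apply: (@algebraic_boundedI _ _ _ _ _ B) => //.
  by split=> // m; rewrite ps_evalE Bf.
by apply/bigmax_leqP => i _; have := hB i; case: (msize _).
Qed.

(** * Gauss' lemma and annihilators with both bounds *)

Definition divides (T : idomainType) (x y : T) := exists z, y = x * z.

(* Prime or invertible: allowing units spares the nondegeneracy side conditions. *)
Definition primal (T : idomainType) (x : T) :=
  x != 0 /\ forall a b, divides x (a * b) -> divides x a \/ divides x b.

(** Units are [primal], so no separate unit factor appears in the product. *)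
Definition is_ufd (T : idomainType) := forall a : T, a != 0 ->
  exists2 s : seq T, (forall x, x \in s -> primal x) & a = \prod_(x <- s) x.

Section Factorial.
Variable R : idomainType.
Implicit Types (x a b c : R) (s t u : seq R) (A B P Q S : {poly R}).

Lemma divides_prod (T : idomainType) (x : T) (s : seq T) : primal x ->
  divides x (\prod_(y <- s) y) ->
  divides x 1 \/ exists2 y, y \in s & divides x y.
Proof.
move=> [_ px]; elim: s => [|y s IH]; first by rewrite big_nil; left.
rewrite big_cons => /px[xy|/IH[x1|[z zs xz]]]; [right|by left|right].
  by exists y => //; rewrite mem_head.
by exists z => //; rewrite in_cons zs orbT.
Qed.

Lemma prod_primal_neq0 s : (forall x, x \in s -> primal x) -> \prod_(x <- s) x != 0.
Proof.
move=> ps; rewrite prodf_seq_neq0; apply/allP => x xs /=; exact: (ps x xs).1.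
Qed.

Lemma divides_polyCP x A : divides x%:P A <-> forall i, divides x A`_i.
Proof.
split=> [[Z ->] i|/boolp.choice[z ez]]; first by exists Z`_i; rewrite coefCM.
exists (\poly_(i < size A) z i); apply/polyP => i; rewrite coefCM coef_poly.
by case: ltnP => Ai; [rewrite ez|rewrite nth_default ?mulr0].
Qed.

Lemma divides_sum x I (r : seq I) (Q : pred I) (F : I -> R) :
  (forall i, Q i -> divides x (F i)) -> divides x (\sum_(i <- r | Q i) F i).
Proof.
move=> xF; elim/big_rec: _ => [|i y Qi [z ->]]; first by exists 0; rewrite mulr0.
by have [z' ->] := xF i Qi; exists (z' + z); rewrite mulrDr.
Qed.

(** If [x] divides neither factor, let [i] and [j] be the first indices of coefficients not
    divisible by [x]. In the coefficient of index [i + j] of the product, all terms but one are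
    divisible by [x]. *)
Lemma primal_polyC x : primal x -> primal x%:P.
Proof.
move=> [xn0 px]; split; first by rewrite polyC_eq0.
move=> A B /divides_polyCP xAB; apply: boolp.contrapT => /boolp.not_orP[nA nB].
have least C : ~ divides x%:P C ->
    exists2 i, ~ divides x C`_i & forall k, (k < i)%N -> divides x C`_k.
  move=> nC; have [i0 ni0] : exists i, ~ divides x C`_i.
    by apply/boolp.existsNP => xC; apply/nC/divides_polyCP.
  have [i [ni li] _] := @ex_least (fun i => ~ divides x C`_i) _ ni0.
  exists i => // k ki; apply: boolp.contrapT => /li; by rewrite leqNgt ki.
have [[i ni li] [j nj lj]] := (least A nA, least B nB).
have ij : (i < (i + j).+1)%N by rewrite ltnS leq_addr.
have [z ez] := xAB (i + j)%N; move: ez; rewrite coefM (bigD1 (Ordinal ij)) //= addKn.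
move=> ez; suff : divides x (A`_i * B`_j) by move=> /px[].
have [w ew] : divides x (\sum_(k < (i + j).+1 | k != Ordinal ij) A`_k * B`_(i + j - k)).
  apply: divides_sum => k; rewrite -val_eqE /= => ki.
  have [lki|lik|eki] := ltngtP k i; last by rewrite eki eqxx in ki.
    by have [w ->] := li k lki; exists (w * B`_(i + j - k)); rewrite mulrA.
  have [w ->] := lj (i + j - k)%N ltac:(have := ltn_ord k; lia).
  by exists (A`_k * w); rewrite mulrCA.
by exists (z - w); rewrite mulrBr -ez -ew addrK.
Qed.

(* Dividing a factorization over the fraction field by constants makes it a
   factorization over [R]: this is Gauss' lemma. *)
Lemma strip_constant s P S Q : (forall x, x \in s -> primal x) ->
  (\prod_(x <- s) x)%:P * Q = P * S ->
  exists P' S' c, [/\ Q = P' * S', c != 0 & P = c%:P * P'].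
Proof.
elim: s P S => [|x s IH] P S ps.
  by rewrite big_nil mul1r => ->; exists P, S, 1; rewrite oner_eq0 mul1r.
have [xn0 px] := primal_polyC (ps x (mem_head _ _)).
have ps' y : y \in s -> primal y by move=> ys; apply: ps; rewrite in_cons ys orbT.
rewrite big_cons polyCM -mulrA => e.
have /px[[P0 eP]|[S0 eS]] : divides x%:P (P * S) by exists ((\prod_(y <- s) y)%:P * Q).
  rewrite eP -mulrA in e; have e' := mulfI xn0 e.
  have [P' [S' [c [-> cn0 eP0]]]] := IH _ _ ps' e'.
  exists P', S', (x * c); split=> //; last by rewrite eP eP0 polyCM mulrA.
  by rewrite mulf_neq0 // -(polyC_eq0 x).
rewrite eS [RHS]mulrCA in e; exact: (IH _ _ ps' (mulfI xn0 e)).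
Qed.

(** A constant dividing [P] divides its leading coefficient. Dividing out the members of [s] that
    divide [P], one at a time, ends because [s] gets shorter. *)
Lemma primitive_part s P : (forall x, x \in s -> primal x) ->
  lead_coef P = \prod_(x <- s) x ->
  exists t u Q, [/\ P = (\prod_(x <- t) x)%:P * Q, forall x, x \in t -> primal x,
    lead_coef Q = \prod_(x <- u) x, forall x, x \in u -> primal x
    & forall x, x \in u -> ~ divides x%:P Q].
Proof.
have [m] := ubnP (size s); elim: m s P => // m IH s P; rewrite ltnS => sm ps eP.
have [[x xs [P1 eP1]]|nx] := boolp.pselect (exists2 x, x \in s & divides x%:P P); last first.
  exists [::], s, P; rewrite big_nil mul1r; split=> // x xs xP; apply: nx; by exists x.
have [xn0 _] := ps x xs.
have eP' : lead_coef P1 = \prod_(y <- rem x s) y.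
  apply: (mulfI xn0); rewrite -[RHS](big_rem x xs (P := predT) (F := id)) -eP eP1.
  by rewrite lead_coefM lead_coefC.
have sm' : (size (rem x s) < m)%N.
  by rewrite size_rem //; case: (s) xs sm => // y s' _; apply.
have [t [u [Q [eQ pt eu pu nu]]]] := IH _ _ sm' (fun y ys => ps y (mem_rem ys)) eP'.
exists (x :: t), u, Q; split=> //; first by rewrite big_cons polyCM -mulrA -eQ.
by move=> y; rewrite in_cons => /orP[/eqP->|/pt //]; apply: ps.
Qed.

(** A primitive polynomial that is irreducible over the fraction field is prime: divisibility over
    the fraction field is first brought down to [R], then the gcd with [Q] is examined. *)
Lemma primal_primitive u Q : is_ufd R ->
  lead_coef Q = \prod_(x <- u) x -> (forall x, x \in u -> primal x) ->
  (forall x, x \in u -> ~ divides x%:P Q) -> (1 < size Q)%N ->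
  (forall c G H, c != 0 -> c%:P * Q = G * H -> (1 < size G < size Q)%N -> False) ->
  primal Q.
Proof.
move=> facR eQ pu nu sQ irrQ.
have Qn0 : Q != 0 by rewrite -size_poly_gt0 ltnW.
have cancel x T : primal x -> divides x%:P (T * Q) -> divides x%:P T.
  move=> px /(primal_polyC px).2[//|xQ].
  have : divides x (\prod_(y <- u) y).
    by rewrite -eQ /lead_coef; move/divides_polyCP: xQ; apply.
  case/(divides_prod px) => [[z z1]|[y yu [m ey]]].
    by exists (z%:P * T); rewrite mulrA -polyCM -z1 mul1r.
  have [yn0 py] := pu y yu.
  (* Here [y = x * m]. If [y] divides [x], it divides [Q], which is excluded; if [y] divides [m],
     then [x] is a unit. *)
  have /py[[k ek]|[k ek]] : divides y (x * m) by exists 1; rewrite mulr1.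
    case: (nu y yu); have [Z ->] := xQ.
    by exists (k%:P * Z); rewrite mulrA -polyCM -ek.
  have k1 : x * k = 1.
    by apply: (mulfI yn0); rewrite mulr1 {2}ey ek mulrCA.
  by exists (k%:P * T); rewrite mulrA -polyCM k1 mul1r.
have strip t A T : (forall x, x \in t -> primal x) ->
    (\prod_(x <- t) x)%:P * A = T * Q -> divides Q A.
  elim: t A T => [|x t IH] A T pt.
    by rewrite big_nil mul1r => ->; exists T; rewrite mulrC.
  have px := pt x (mem_head _ _); rewrite big_cons polyCM -mulrA => e.
  have /(cancel x T px)[T' eT] : divides x%:P (T * Q) by exists ((\prod_(y <- t) y)%:P * A).
  move: e; rewrite eT -mulrA => /(mulfI (primal_polyC px).1).
  by apply: IH => y yt; apply: pt; rewrite in_cons yt orbT.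
(* The relation [%|] allows a nonzero constant multiple of [A]; the factors of this constant are
   cancelled one by one. *)
have dvd A : Q %| A -> divides Q A.
  case/Pdiv.Idomain.dvdpP => -[c T] /= cn0 e; have [t pt et] := facR c cn0.
  by apply: (strip t A T pt); rewrite -et mul_polyC.
split=> // A B [Z eAB].
have QAB : Q %| A * B by rewrite eAB dvdp_mulr.
(* The gcd of [Q] and [A] is constant, and then [Q] divides [B], or it is associated to [Q], since
   [irrQ] excludes intermediate degrees. *)
have [g1|g1] := leqP (size (gcdp Q A)) 1.
  right; apply: dvd; rewrite -(@Gauss_dvdpr _ B A Q) //.
  rewrite /coprimep eqn_leq g1 size_poly_gt0 gcdp_eq0 (negPf Qn0) //.
left; apply: dvd; have gQ := dvdp_gcdl Q A.
have [gltQ|Qleg] := ltnP (size (gcdp Q A)) (size Q).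
  have /Pdiv.Idomain.dvdpP[[c T] /= cn0 e] := gQ.
  by case: (irrQ c (gcdp Q A) T cn0); rewrite ?g1 // [RHS]mulrC -e mul_polyC.
have : gcdp Q A %= Q by rewrite -(dvdp_size_eqp gQ) eqn_leq Qleg dvdp_leq.
by move=> /eqp_dvdl <-; apply: dvdp_gcdr.
Qed.

End Factorial.

(** Induction on the degree. A proper factorization up to a constant becomes one over [R] by
    [strip_constant]; without any, the primitive part is prime and the content factors in [R]. *)
Lemma ufd_poly (R : idomainType) : is_ufd R -> is_ufd {poly R}.
Proof.
move=> facR A; have [m] := ubnP (size A); elim: m A => // m IH A; rewrite ltnS => Am An0.
have [A1|A1] := leqP (size A) 1.
  rewrite (size1_polyC A1); have : A`_0 != 0 by rewrite -(polyC_eq0 A`_0) -size1_polyC.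
  case/facR => s ps ->; exists (map polyC s).
    by move=> x /mapP[y ys ->]; apply/primal_polyC/ps.
  by rewrite rmorph_prod big_map.
have [[c [G [H [cn0 e sG]]]]|irr] := boolp.pselect (exists c G H,
    [/\ c != 0, c%:P * A = G * H & (1 < size G < size A)%N]).
  have [s ps es] := facR c cn0; rewrite es in e.
  have [G' [H' [c' [eA c'n0 eG]]]] := strip_constant ps e.
  have sG' : size G' = size G by rewrite eG mul_polyC size_scale.
  move: (An0); rewrite eA mulf_eq0 negb_or => /andP[Gn0 Hn0].
  have sA : size A = (size G' + size H').-1 by rewrite eA size_mul.
  have hG : (size G' < m)%N by move/andP: sG => [_ /leq_trans]; rewrite sG'; apply.
  have hH : (size H' < m)%N.
    by move/andP: sG; rewrite -sG' => -[g1 _]; apply: leq_trans Am; rewrite sA; lia.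
  have [[s1 p1 ->] [s2 p2 ->]] := (IH G' hG Gn0, IH H' hH Hn0).
  exists (s1 ++ s2); last by rewrite big_cat.
  by move=> x; rewrite mem_cat => /orP[/p1|/p2].
have : lead_coef A != 0 by rewrite lead_coef_eq0.
case/facR => s ps es.
have [t [u [Q [eA pt eu pu nu]]]] := primitive_part ps es.
have tn0 := prod_primal_neq0 pt.
have sQ : size Q = size A by rewrite eA mul_polyC size_scale.
have pQ : primal Q.
  apply: (primal_primitive facR eu pu nu); rewrite sQ // => c G H cn0 e sG; apply: irr.
  exists c, ((\prod_(x <- t) x)%:P * G), H; split=> //.
    by rewrite eA mulrCA e mulrA.
  by rewrite mul_polyC size_scale.
exists (rcons (map polyC t) Q).
  move=> x; rewrite mem_rcons in_cons => /orP[/eqP-> //|/mapP[y yt ->]].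
  exact/primal_polyC/pt.
by rewrite -cats1 big_cat big_seq1 /= big_map eA rmorph_prod.
Qed.

Lemma ufd_iso (R S : idomainType) (phi : {rmorphism R -> S}) (psi : S -> R) :
  cancel phi psi -> cancel psi phi -> is_ufd S -> is_ufd R.
Proof.
move=> K K' facS a an0.
have inj := can_inj K.
have div x y : divides (phi x) (phi y) -> divides x y.
  by move=> [z e]; exists (psi z); apply: inj; rewrite rmorphM /= K'.
have : phi a != 0 by rewrite (raddf_eq0 _ inj).
case/facS => s ps es; exists (map psi s).
  move=> _ /mapP[y ys ->]; have [yn0 py] := ps y ys; split.
    by apply: contraNneq yn0 => e; rewrite -(K' y) e rmorph0.
  move=> b c [z e]; have : divides y (phi b * phi c).
    by exists (phi z); rewrite -rmorphM e rmorphM /= K'.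
  by case/py => h; [left|right]; apply: div; rewrite K'.
apply: inj; rewrite es rmorph_prod big_map; apply: eq_bigr => x _.
by rewrite /= K'.
Qed.

Lemma ufd_field (K : fieldType) : is_ufd K.
Proof.
move=> a an0; exists [:: a]; last by rewrite big_seq1.
move=> x; rewrite inE => /eqP ->; split=> // b c _; left.
by exists (a^-1 * b); rewrite mulVKf.
Qed.

(** * Factoriality of polynomial rings in several variables *)

Section LastVariable.
Variables (n : nat) (R : idomainType).

Definition mnm_init (k : 'X_{1..n.+1}) : 'X_{1..n} :=
  [multinom k (widen_ord (leqnSn n) i) | i < n].

Definition mnm_rcons (m : 'X_{1..n}) (i : nat) : 'X_{1..n.+1} :=
  [multinom of rcons m i].

Lemma mnm_rcons_widen m i (j : 'I_n) : mnm_rcons m i (widen_ord (leqnSn n) j) = m j.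
Proof. by rewrite !(mnm_nth 0%N) /= nth_rcons size_tuple ltn_ord. Qed.

Lemma mnm_init_rcons m i : mnm_init (mnm_rcons m i) = m.
Proof. by apply/mnmP => j; rewrite mnmE mnm_rcons_widen. Qed.

Lemma mnm_rcons_last m i : mnm_rcons m i ord_max = i.
Proof. by rewrite (mnm_nth 0%N) /= nth_rcons size_tuple ltnn eqxx. Qed.

Lemma mnm_rconsK k : mnm_rcons (mnm_init k) (k ord_max) = k.
Proof.
apply/mnmP => j; case: (unliftP ord_max j) => [i ->|->]; last exact: mnm_rcons_last.
have -> : lift ord_max i = widen_ord (leqnSn n) i by apply/val_inj; rewrite /= /bump leqNgt ltn_ord.
by rewrite mnm_rcons_widen mnmE.
Qed.

(** Since [muni] preserves every coefficient, the cancellation [of_muniK] also yields the opposite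
    one. *)
Lemma coef_muni (q : {mpoly R[n.+1]}) i m : ((muni q)`_i)@_m = q@_(mnm_rcons m i).
Proof.
rewrite muniE coef_sum raddf_sum [in RHS](mpolyE q) raddf_sum.
apply: eq_bigr => k _ /=; rewrite coefZ coefXn !mcoeffZ mcoeffX.
rewrite -/(mnm_init k) -(mpolyC_nat n) mulrC mcoeffCM mcoeffZ mcoeffX mulrCA; congr (_ * _).
rewrite -natrM mulnb; congr (_%:R); congr nat_of_bool.
apply/andP/eqP => [[/eqP-> /eqP<-]|->]; first by rewrite mnm_rconsK.
by rewrite mnm_init_rcons mnm_rcons_last !eqxx.
Qed.

Definition of_muni (Q : {poly {mpoly R[n]}}) : {mpoly R[n.+1]} :=
  \sum_(i < size Q) \sum_(m <- msupp Q`_i) Q`_i@_m *: 'X_[mnm_rcons m i].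

Lemma of_muniK : cancel of_muni (@muni n R).
Proof.
move=> Q; rewrite /of_muni raddf_sum.
have muniX m i : muni 'X_[mnm_rcons m i] = 'X_[m] *: 'X^i :> {poly {mpoly R[n]}}.
  rewrite muniE msuppX big_seq1 mcoeffX eqxx scale1r -/(mnm_init _).
  by rewrite mnm_init_rcons mnm_rcons_last.
rewrite -[RHS]coefK poly_def; apply: eq_bigr => i _; rewrite raddf_sum.
rewrite {3}(mpolyE Q`_i) scaler_suml; apply: eq_bigr => m _ /=.
by rewrite muniZ muniX scalerA mul_mpolyC.
Qed.

Lemma muniK : cancel (@muni n R) of_muni.
Proof.
move=> q; apply/mpolyP => k; rewrite -(mnm_rconsK k) -!coef_muni.
by rewrite of_muniK.
Qed.

End LastVariable.

Lemma ufd_mpoly n (K : fieldType) : is_ufd {mpoly K[n]}.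
Proof.
elim: n => [|n IH].
  apply: (@ufd_iso _ _ (mcoeff 0%MM) (@mpolyC 0 K) _ _ (@ufd_field K)).
    move=> q; apply/mpolyP => m; rewrite mcoeffC.
    have -> : m = 0%MM by apply/mnmP => -[].
    by rewrite eqxx mulr1.
  by move=> c; apply: mpolyCK.
exact: (@ufd_iso _ _ (@muni n K) _ (@muniK n K) (@of_muniK n K) (ufd_poly IH)).
Qed.

(** * One annihilator for both the degree and the height *)

Section Height.
Variables (n : nat) (K : fieldType).
Implicit Types P Q S : {poly {mpoly K[n]}}.

Lemma first_max (u : nat -> nat) N : (forall k, (N <= k)%N -> u k = 0%N) ->
  exists i, (forall k, u k <= u i)%N /\ (forall k, k < i -> u k < u i)%N.
Proof.
move=> u0; suff [i [ui li]] : exists i, (forall k, k < N -> u k <= u i)%N /\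
    (forall k, k < i -> u k < u i)%N.
  exists i; split=> // k; case: (ltnP k N) => [|/u0 ->] //; exact: ui.
elim: N {u0} => [|N [i [ui li]]]; first by exists 0%N.
have [uN|uN] := leqP (u N) (u i).
  by exists i; split=> // k; rewrite ltnS leq_eqVlt => /orP[/eqP->|/ui].
exists N; split=> k; last by move=> /ui /leq_ltn_trans; apply.
by rewrite ltnS leq_eqVlt => /orP[/eqP-> //|/ui /leq_trans]; apply; apply: ltnW.
Qed.

(* In the product of the first coefficients of maximal degree of [P] and [S],
   nothing cancels the part of top degree. *)
Lemma height_divisor h P S : P * S != 0 ->
  (forall i, msize (P * S)`_i <= h)%N -> forall i, (msize P`_i <= h)%N.
Proof.
rewrite mulf_eq0 negb_or => /andP[Pn0 Sn0] hPS k0.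
have fm Q : exists i, (forall k, msize Q`_k <= msize Q`_i)%N /\
    (forall k, k < i -> msize Q`_k < msize Q`_i)%N.
  by apply: (@first_max (fun k => msize Q`_k) (size Q)) => k kQ; rewrite nth_default ?msize0.
have pos Q i : Q != 0 -> (forall k, msize Q`_k <= msize Q`_i)%N -> Q`_i != 0.
  move=> Qn0 mi; apply: contraNneq Qn0 => Qi0; rewrite -lead_coef_eq0 -msize_poly_eq0.
  by rewrite -leqn0; apply: leq_trans (mi _) _; rewrite Qi0 msize0.
have [[i [Pi li]] [j [Sj lj]]] := (fm P, fm S).
apply: leq_trans (Pi k0) _.
have [Pin0 Sjn0] := (pos P i Pn0 Pi, pos S j Sn0 Sj).
have Pi_gt0 : (0 < msize P`_i)%N by rewrite lt0n msize_poly_eq0.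
have Sj_gt0 : (0 < msize S`_j)%N by rewrite lt0n msize_poly_eq0.
have ij : (i < (i + j).+1)%N by rewrite ltnS leq_addr.
have eM := msizeM Pin0 Sjn0.
have := hPS (i + j)%N; rewrite coefM (bigD1 (Ordinal ij)) //= addKn.
set O := \sum_(k < _ | _) _ => hO.
have Olt : (msize O <= (msize P`_i + msize S`_j).-2)%N.
  apply: leq_trans (msize_sum _ _ _) _; apply/bigmax_leqP => k; rewrite -val_eqE /= => ki.
  have [->|pn0] := eqVneq P`_k 0; first by rewrite mul0r msize0.
  have [->|sn0] := eqVneq S`_(i + j - k) 0; first by rewrite mulr0 msize0.
  rewrite msizeM //; have kij := ltn_ord k.
  have arith a b a' b' : (a < a' -> b <= b' -> (a + b).-1 <= (a' + b').-2)%N by lia.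
  have [lki|lik|eki] := ltngtP k i; last by rewrite eki eqxx in ki.
    by apply: arith; [exact: li|exact: Sj].
  rewrite addnC [(msize P`_i + _)%N]addnC; apply: arith; last exact: Pi.
  by apply: lj; lia.
have : (msize (P`_i * S`_j) <= maxn h (msize O))%N.
  rewrite -[P`_i * _](addrK O); apply: leq_trans (msizeD_le _ _) _.
  by rewrite msizeN geq_max !leq_max hO leqnn orbT.
rewrite eM leq_max; move: Pi_gt0 Sj_gt0 Olt.
by move: (msize P`_i) (msize S`_j) (msize O) => a b o; clear; lia.
Qed.

(** Pseudo-division of [Q] by an annihilator [P0] of least degree leaves no remainder. By Gauss'
    lemma [P0] is then a constant times a true divisor [A] of [Q], which has the degree of [P0] and
    at most the height of [Q]. *)
Lemma annihilator_bounded (f : series n K) d h P Q :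
  annihilates P f -> (size P <= d.+1)%N ->
  annihilates Q f -> (forall i, msize Q`_i <= h)%N ->
  exists A, [/\ annihilates A f, (size A <= d.+1)%N & forall i, (msize A`_i <= h)%N].
Proof.
move=> aP sP aQ hQ.
have [e [[P0 aP0 sP0] minP0] ed] := @ex_least
  (fun m => exists2 P, annihilates P f & (size P <= m)%N) _ (ex_intro2 _ _ P aP sP).
have anE A : annihilates A f <-> A != 0 /\ (map_poly (@ser_of_mpoly n K) A).[f] = 0.
  by split=> -[An0 Af]; split=> //; [rewrite -ps_evalE; apply/seriesP|move=> m; rewrite ps_evalE Af].
have [P0n0 P0f] := (anE P0).1 aP0; have [Qn0 Qf] := (anE Q).1 aQ.
have eDiv := Pdiv.Idomain.divp_eq Q P0.
(* A nonzero remainder would annihilate [f] and have smaller degree than [P0]. *)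
have rem0 : Q %% P0 = 0.
  apply/eqP/negPn/negP => rn0; have : annihilates (Q %% P0) f.
    apply/anE; split=> //; have := congr1 (fun A => (map_poly (@ser_of_mpoly n K) A).[f]) eDiv.
    rewrite map_polyZ hornerZ Qf mulr0 rmorphD rmorphM hornerD hornerM P0f mulr0 add0r.
    by move=> <-.
  move=> ar; have : (e <= size (Q %% P0)%R)%N by apply: minP0; exists (Q %% P0).
  by rewrite leqNgt; move/negP; apply; apply: leq_trans sP0; rewrite ltn_modp.
move: eDiv; rewrite rem0 addr0.
set c := _ ^+ _; have cn0 : c != 0 by rewrite expf_neq0 // lead_coef_eq0.
rewrite -mul_polyC mulrC => eDiv; have [s ps es] := @ufd_mpoly n K c cn0.
rewrite mulrC [RHS]mulrC es in eDiv.
have [A [S [c' [eQ c'n0 eP0]]]] := strip_constant ps eDiv.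
exists A; split.
- apply/anE; split; first by apply: contraNneq Qn0 => A0; rewrite eQ A0 mul0r.
  move: P0f; rewrite eP0 rmorphM /= map_polyC hornerM hornerC /=.
  case/ser_mulf_eq0/orP => /eqP // c'0; case/eqP: c'n0.
  by apply: (@ser_of_mpoly_inj n K); rewrite c'0 rmorph0.
- by apply: leq_trans ed; apply: leq_trans sP0; rewrite eP0 mul_polyC size_scale.
- by apply: (@height_divisor h A S); rewrite -eQ.
Qed.

End Height.

(** * Reduction modulo p *)

Section Reduction.
Variables (n d h p : nat).
Hypothesis p_prime : prime p.
Let index := ('I_d.+1 * 'X_{1..n < h.+1})%type.

(** Denominators are cleared first. Then, as long as [p] divides all the integers, they are divided
    by [p]; the nonzero [z x0] decreases in absolute value, so this stops. *)
Lemma integral_multiple (I : finType) (c : I -> rat) x0 : c x0 != 0 ->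
  exists z : I -> int, (exists2 l : rat, l != 0 & forall x, (z x)%:~R = l * c x) /\
    exists x, ~~ (p %| z x)%Z.
Proof.
move=> cx0; have p_gt1 := prime_gt1 p_prime.
suff descent (z : I -> int) : z x0 != 0 ->
    (exists2 l : rat, l != 0 & forall x, (z x)%:~R = l * c x) ->
    exists z : I -> int, (exists2 l : rat, l != 0 & forall x, (z x)%:~R = l * c x) /\
    exists x, ~~ (p %| z x)%Z.
  pose D := \prod_x denq (c x).
  have Dn0 : D%:~R != 0 :> rat.
    by rewrite intr_eq0 prodf_seq_neq0; apply/allP => x _; rewrite denq_neq0.
  have ez x : (numq (c x) * \prod_(y | y != x) denq (c y))%:~R = D%:~R * c x.
    have -> : D = denq (c x) * \prod_(y | y != x) denq (c y) by rewrite /D (bigD1 x).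
    by rewrite !intrM numqE [RHS]mulrC mulrA.
  apply: (descent (fun x => numq (c x) * \prod_(y | y != x) denq (c y))).
    by rewrite -(intr_eq0 rat) ez mulf_neq0.
  by exists D%:~R.
have [m] := ubnP `|z x0|%N; elim: m z => // m IH z; rewrite ltnS => zm zx0 [l ln0 el].
have [[x ndvd]|dvd] := boolp.pselect (exists x, ~~ (p %| z x)%Z).
  by exists z; split; [exists l|exists x].
have pz x : z x = (z x %/ p)%Z * p.
  rewrite divzK //; apply/negPn/negP => ndvd; apply: dvd; by exists x.
have pn0 : p%:~R != 0 :> rat by rewrite intr_eq0 -lt0n prime_gt0.
apply: (IH (fun x => (z x %/ p)%Z)).
- apply: leq_trans zm; rewrite [in X in (_ < X)%N]pz abszM absz_nat.
  rewrite ltn_Pmulr // absz_gt0; apply: contraNneq zx0 => e.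
  by rewrite pz e mul0r.
- by apply: contraNneq zx0 => e; rewrite pz e mul0r.
- exists (l / p%:~R); first by rewrite mulf_neq0 ?invr_eq0.
  by move=> x; rewrite mulrAC -el [in RHS]pz rmorphM mulfK.
Qed.

(** The polynomial is written through its family of coefficients, in which the equation is linear;
    this form makes sense over [int], [rat] and ['F_p] alike. *)
Definition box_poly (R : comNzRingType) (c : index -> R) : {poly {mpoly R[n]}} :=
  \sum_(x : index) (c x *: 'X_[(x.2 : 'X_{1..n < h.+1})]) *: 'X^(x.1).

Lemma horner_box_poly (R : comNzRingType) (c : index -> R) (g : series n R) m :
  (map_poly (@ser_of_mpoly n R) (box_poly c)).[g] m =
  \sum_(x : index) c x * (serX R x.2 * g ^+ x.1) m.
Proof.
rewrite /box_poly rmorph_sum horner_sum ser_sum; apply: eq_bigr => x _ /=.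
rewrite map_polyZ map_polyXn hornerZ hornerXn !serM mulr_sumr /=.
by apply: eq_bigr => k _; rewrite /serX !ser_of_mpolyE (mcoeffZ (c x)) mulrA.
Qed.

Lemma coef_box_poly (R : comNzRingType) (c : index -> R) (x : index) :
  ((box_poly c)`_x.1)@_x.2 = c x.
Proof.
rewrite /box_poly coef_sum raddf_sum (bigD1 x) //= [X in _ + X]big1 ?addr0; last first.
  move=> y yx; rewrite coefZ coefXn; case: eqP => [e1|_]; last by rewrite mulr0 mcoeff0.
  rewrite mulr1 mcoeffZ mcoeffX; case: eqP => [e2|_]; last by rewrite mulr0.
  case/eqP: yx; move: x y e1 e2 => [x1 x2] [y1 y2] /= e1 e2.
  by congr (_, _); apply/val_inj.
by rewrite coefZ coefXn eqxx mulr1 mcoeffZ mcoeffX eqxx mulr1.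
Qed.

Lemma box_polyE (R : comNzRingType) (P : {poly {mpoly R[n]}}) :
  (size P <= d.+1)%N -> (forall i, msize P`_i <= h.+1)%N ->
  P = box_poly (fun x => (P`_x.1)@_x.2).
Proof.
move=> sP hP; rewrite /box_poly.
rewrite -(pair_bigA _ (fun (i : 'I_d.+1) (k : 'X_{1..n < h.+1}) => (P`_i@_k *: 'X_[k]) *: 'X^i)) /=.
rewrite -[LHS]coefK poly_def (big_ord_widen _ (fun i => P`_i *: 'X^i) sP) big_mkcond.
apply: eq_bigr => i _; rewrite -scaler_suml -(mpolywE (hP i)).
by case: ltnP => // iP; rewrite nth_default // scale0r.
Qed.

Lemma size_box_poly (R : comNzRingType) (c : index -> R) : (size (box_poly c) <= d.+1)%N.
Proof.
apply: leq_trans (size_sum _ _ _) _; apply/bigmax_leqP => x _.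
by apply: leq_trans (size_scale_leq _ _) _; rewrite size_polyXn.
Qed.

Lemma msize_box_poly (R : comNzRingType) (c : index -> R) i :
  (msize (box_poly c)`_i <= h.+1)%N.
Proof.
rewrite /box_poly coef_sum; apply: leq_trans (msize_sum _ _ _) _.
apply/bigmax_leqP => x _; rewrite coefZ coefXn; case: eqP => _; last first.
  by rewrite mulr0 msize0.
rewrite mulr1; apply: leq_trans (mmeasureZ_le _ _ _) _.
by rewrite msizeX bmdeg.
Qed.

(** Each coefficient of [P(f) = 0] is a linear relation between the coefficients of [P] with integer
    multipliers [e x m]. It passes to the integral multiple [z], and then modulo [p], where [z] is
    still nonzero. *)
Lemma reduction_mod_p (f : series n int) (P : {poly {mpoly rat[n]}}) :
  annihilates P (ps_intr rat f) -> (size P <= d.+1)%N ->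
  (forall i, msize P`_i <= h.+1)%N ->
  exists Q : {poly {mpoly 'F_p[n]}}, [/\ annihilates Q (ps_intr 'F_p f),
    (size Q <= d.+1)%N & forall i, (msize Q`_i <= h.+1)%N].
Proof.
move=> [Pn0 Pf] sP hP; set c := fun x : index => (P`_x.1)@_x.2.
have eP : P = box_poly c := box_polyE sP hP.
have [x0 cx0] : exists x, c x != 0.
  apply: boolp.contrapT => /boolp.forallNP c0; case/eqP: Pn0; rewrite eP /box_poly big1 // => x _.
  by move: (c0 x) => /negP; rewrite negbK => /eqP ->; rewrite !scale0r.
have [z [[l ln0 el] [x1 ndvd]]] := integral_multiple cx0.
pose e (x : index) m := (serX int x.2 * f ^+ x.1) m.
have eE (R : comNzRingType) (x : index) m : (serX R x.2 * (ps_intr R f : series n R) ^+ x.1) m = (e x m)%:~R.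
  rewrite -[RHS]/(ser_map (intmul 1) (serX int x.2 * f ^+ x.1) m).
  by rewrite rmorphM rmorphXn /= ser_mapX.
have relZ m : \sum_x z x * e x m = 0.
  apply: (@intr_inj rat); rewrite rmorph_sum /=.
  transitivity (l * \sum_x c x * (e x m)%:~R).
    by rewrite mulr_sumr; apply: eq_bigr => x _; rewrite rmorphM /= el mulrA.
  have := Pf m; rewrite ps_evalE eP horner_box_poly.
  by under eq_bigr => x _ do rewrite eE; move=> ->; rewrite mulr0.
exists (box_poly (fun x => (z x)%:~R)); split; [split|exact: size_box_poly|exact: msize_box_poly].
  apply: contra ndvd => /eqP B0; rewrite (dvdz_pcharf (pchar_Fp p_prime)).
  by rewrite -(coef_box_poly (fun x => (z x)%:~R : 'F_p) x1) B0 coef0 mcoeff0.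
move=> m; rewrite ps_evalE horner_box_poly.
under eq_bigr => x _ do rewrite eE -rmorphM.
by rewrite -rmorph_sum /= relZ.
Qed.

End Reduction.

(** * Recursiveness of the constant *)

Lemma rec_nth k i : (i < k)%N -> recursive (fun v : k.-tuple nat => nth 0%N v i).
Proof.
by move=> ik; apply: (rec_proj (i := Ordinal ik)) => v; rewrite (tnth_nth 0%N).
Qed.

Lemma rec_comp1 k (f : 1.-tuple nat -> nat) (g : k.-tuple nat -> nat) :
  recursive f -> recursive g -> recursive (fun v => f [tuple g v]).
Proof.
move=> rf rg; apply: (@rec_comp k 1 f (fun=> g)) => // v.
by congr f; apply: eq_from_tnth => i; rewrite tnth_mktuple (ord1 i).
Qed.

Lemma rec_comp2 k (f : 2.-tuple nat -> nat) (g1 g2 : k.-tuple nat -> nat) :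
  recursive f -> recursive g1 -> recursive g2 ->
  recursive (fun v => f [tuple g1 v; g2 v]).
Proof.
move=> rf r1 r2; apply: (@rec_comp k 2 f (fun i => if i == ord0 then g1 else g2)) => //.
  by move=> i; case: ifP.
by move=> v; congr f; apply: eq_from_tnth => i; rewrite tnth_mktuple; case: i => -[|[|]].
Qed.

Lemma rec_add : recursive (fun v : 2.-tuple nat => nth 0%N v 0 + nth 0%N v 1)%N.
Proof.
apply: (@rec_prim 1 (fun v => nth 0%N v 0) (fun v => (nth 0%N v 1).+1)).
- exact: rec_nth.
- by apply: (@rec_comp1 3 (fun v => (tnth v ord0).+1)); [exact: rec_succ|exact: rec_nth].
- by [].
- by [].
Qed.

Lemma rec_mul : recursive (fun v : 2.-tuple nat => nth 0%N v 0 * nth 0%N v 1)%N.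
Proof.
apply: (@rec_prim 1 (fun=> 0%N) (fun v => nth 0%N v 1 + nth 0%N v 2)%N).
- exact: rec_zero.
- by apply: (@rec_comp2 3 _ (fun v => nth 0%N v 1) (fun v => nth 0%N v 2) rec_add); exact: rec_nth.
- by [].
- by move=> y v /=; rewrite mulSn addnC.
Qed.

(** The exponent is the first argument because primitive recursion runs on the head of the tuple. *)
Lemma rec_exp : recursive (fun v : 2.-tuple nat => nth 0%N v 1 ^ nth 0%N v 0)%N.
Proof.
apply: (@rec_prim 1 (fun=> 1%N) (fun v => nth 0%N v 1 * nth 0%N v 2)%N).
- by apply: (@rec_comp1 1 (fun v => (tnth v ord0).+1) (fun=> 0%N)); [exact: rec_succ|exact: rec_zero].
- by apply: (@rec_comp2 3 _ (fun v => nth 0%N v 1) (fun v => nth 0%N v 2) rec_mul); exact: rec_nth.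
- by [].
- by move=> y v /=; rewrite expnSr.
Qed.

(** For [v = (n, d, h)] this is the number [N] of coefficients of a numerator. *)
Definition dim_bound (v : 3.-tuple nat) : nat :=
  ((nth 0 v 1).+1 * (nth 0 v 2).+1 ^ nth 0 v 0)%N.

Lemma rec_dim_bound : recursive dim_bound.
Proof.
have succ i : (i < 3)%N -> recursive (fun v : 3.-tuple nat => (nth 0%N v i).+1).
  by move=> i3; apply: (@rec_comp1 3 (fun v => (tnth v ord0).+1)); [exact: rec_succ|exact: rec_nth].
apply: (@rec_comp2 3 _ (fun v => (nth 0%N v 1).+1)
  (fun v => (nth 0%N v 2).+1 ^ nth 0%N v 0)%N rec_mul); first exact: succ.
by apply: (@rec_comp2 3 _ (fun v => nth 0%N v 0) (fun v => (nth 0%N v 2).+1) rec_exp);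
  [exact: rec_nth|exact: succ].
Qed.

(** * Uniform bounds for the reductions of the diagonal *)

Theorem theorem1p2 :
  exists A : 3.-tuple nat -> nat,
    recursive A /\
    forall n d h : nat, (0 < n)%N -> (0 < d)%N -> (0 < h)%N ->
    forall f : pseries n int,
      algebraic_bounded (ps_intr rat f) d h ->
      forall p : nat, prime p ->
        let a := A [tuple n; d; h] in
        algebraic_bounded (ps_intr 'F_p (diagonal f))
          (p ^ a)%N (a ^ 2 * p ^ (a + 1))%N.
Proof.
exists dim_bound; split; first exact: rec_dim_bound.
move=> n d h _ _ _ f [_ [e [[P aP sP] _] ed] [k [[Q aQ hQ] _] kh]] p p_prime a.
have hQ' i : (msize Q`_i <= h.+1)%N.
  have [iQ|Qi] := ltnP i (size Q); last by rewrite nth_default ?msize0.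
  have : ((msize Q`_i).-1 <= h)%N.
    apply: leq_trans kh; rewrite -hQ.
    exact: (leq_bigmax (F := fun i : 'I_(size Q) => (msize Q`_i).-1) (Ordinal iQ)).
  by case: (msize _).
have [B [aB sB hB]] := annihilator_bounded aP (leq_trans sP (ed : (e.+1 <= d.+1)%N)) aQ hQ'.
have [C [aC sC hC]] := reduction_mod_p p_prime aB sB hB.
have prime_field (c : 'F_p) : exists k : nat, c = k%:R by exists c; rewrite natr_Zp.
have [alg [e1 he1 le1] [e2 he2 le2]] :=
  diagonal_bounded (pchar_Fp p_prime) (card_Fp p_prime) prime_field aC sC hC.
split=> //; first by exists e1.
(* The height obtained is at most [a * p ^ a], which is below [a ^ 2 * p ^ (a + 1)]. *)
exists e2 => //; apply: (leq_trans le2); rewrite -[X in (X * _ <= _)%N]/a.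
apply: leq_mul; first by rewrite -{1}[a]muln1 leq_mul2l; case: (a).
by rewrite leq_exp2l ?prime_gt1 // leq_addr.
Qed.
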